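(* Let $\sigma\in\mathcal{D}$ and $\varepsilon\in(0,1]$. Then for any state $\omega\in B_\varepsilon(\sigma)$, $$|S(\omega)-S(\sigma)|\le\max\{S(\rho^*_\varepsilon(\sigma))-S(\sigma),\;S(\sigma)-S(\rho_{*,\varepsilon}(\sigma))\}\qquad(1)$$ and $$\max\{S(\rho^*_\varepsilon(\sigma))-S(\sigma),\;S(\sigma)-S(\rho_{*,\varepsilon}(\sigma))\}\le\begin{cases}\varepsilon\log(d-1)+h(\varepsilon)&\text{if }\varepsilon<1-\frac1d,\\ \log d&\text{if }\varepsilon\ge1-\frac1d.\end{cases}\qquad(2)$$ Moreover, equality holds in (2) if and only if one of the following holds: 1. $\sigma$ is a pure state; in this case, in an orthonormal basis in which $\sigma=\mathrm{diag}(1,0,\dots,0)$, $\rho^*_\varepsilon(\sigma)=\mathrm{diag}(1-\varepsilon,\frac{\varepsilon}{d-1},\dots,\frac{\varepsilon}{d-1})$ if $\varepsilon<1-\frac1d$ and $\rho^*_\varepsilon(\sigma)=\mathbf{1}/d$ if $\varepsilon\ge1-\frac1d$. 2. $\varepsilon<1-\frac1d$ and $\sigma=\mathrm{diag}(1-\varepsilon,\frac{\varepsilon}{d-1},\dots,\frac{\varepsilon}{d-1})$ in some orthonormal basis; in this case $\rho_{*,\varepsilon}(\sigma)$ is a pure state. 3. $\varepsilon\ge1-\frac1d$ and $\sigma=\tau=\mathbf{1}/d$; in this case $\rho_{*,\varepsilon}(\sigma)$ is a pure state.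
   Context: $\mathcal{H}$ is a complex Hilbert space of finite dimension $d\ge 2$; $\mathcal{D}$ is the set of states (density matrices: positive semidefinite operators on $\mathcal{H}$ of trace one); $\tau=\frac1d\mathbf{1}$; $\|A\|_1=\mathrm{Tr}|A|$; $B_\varepsilon(\sigma)=\{\omega\in\mathcal{D}:\frac12\|\omega-\sigma\|_1\le\varepsilon\}$. $\log$ is base 2, $S(\rho)=-\mathrm{Tr}(\rho\log\rho)$ is the von Neumann entropy (with $0\log0=0$), and $h(\varepsilon)=-\varepsilon\log\varepsilon-(1-\varepsilon)\log(1-\varepsilon)$ is the binary entropy. A pure state is a rank-one state. Let $\sigma=\sum_{i=1}^d\mu_i|i\rangle\langle i|$ be an eigendecomposition with $\mu_1\ge\dots\ge\mu_d$ and $(|i\rangle)$ an orthonormal basis. Definition of $\rho^*_\varepsilon(\sigma)$: if $\frac12\|\sigma-\tau\|_1\le\varepsilon$, set $\rho^*_\varepsilon(\sigma)=\tau$. If $\frac12\|\sigma-\tau\|_1>\varepsilon$, there are a unique pair $(\alpha_1,n)\in[0,1]\times\{1,\dots,d-1\}$ with $\sum_{i=d-n+1}^d|\alpha_1-\mu_i|=\varepsilon$ and $\mu_{d-n+1}<\alpha_1\le\mu_{d-n}$, and a unique pair $(\alpha_2,m)\in[0,1]\times\{1,\dots,d-1\}$ with $\sum_{i=1}^m|\alpha_2-\mu_i|=\varepsilon$ and $\mu_{m+1}\le\alpha_2<\mu_m$; moreover $\alpha_1<\frac1d<\alpha_2$ (so $m\le d-n$). Then $$\rho^*_\varepsilon(\sigma)=\sum_{i=1}^m\alpha_2|i\rangle\langle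 i|+\sum_{i=m+1}^{d-n}\mu_i|i\rangle\langle i|+\sum_{i=d-n+1}^d\alpha_1|i\rangle\langle i|.$$ Definition of $\rho_{*,\varepsilon}(\sigma)$: write $q_i=\mu_i$ and set $\rho_{*,\varepsilon}(\sigma)=\sum_{i=1}^d p_{i*}|i\rangle\langle i|$, where: if $q_d>\varepsilon$, $(p_{i*})=(q_1+\varepsilon,q_2,\dots,q_{d-1},q_d-\varepsilon)$. Otherwise let $\ell\in\{1,\dots,d-1\}$ be the largest index with $Q_\ell:=\sum_{j=d-\ell+1}^d q_j\le\varepsilon$. If $\ell=d-1$, $(p_{i*})=(1,0,\dots,0)$. If $\ell<d-1$, $p_{1*}=q_1+\varepsilon$, $p_{j*}=q_j$ for $2\le j\le d-\ell-1$, $p_{(d-\ell)*}=q_{d-\ell}-(\varepsilon-Q_\ell)$, and $p_{j*}=0$ for $j\ge d-\ell+1$. *)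

(* Defs.v *)
From HB Require Import structures.
From mathcomp Require Import all_boot all_order all_algebra.
From mathcomp Require Export complex.
From mathcomp Require Import all_classical all_reals all_analysis.
Set Implicit Arguments.
Unset Strict Implicit.
Unset Printing Implicit Defensive.
Import Order.TTheory GRing.Theory Num.Theory.
Local Open Scope ring_scope.
Local Open Scope complex_scope.
Local Open Scope sesquilinear_scope.
Local Open Scope classical_set_scope.

(* The Hilbert space is C^d with C = R[i] and its standard inner product;
   operators are d x d matrices. *)
Section QuantumStates.
Variables (R : realType) (d : nat).
Notation C := R[i].
Implicit Types (A sigma omega rho U : 'M[C]_d) (eps : R) (mu q p : nat -> R).

Definition log2 (x : R) : R := ln x / ln 2.

Definition psdmx A : Prop :=
  A \is hermsymmx /\ forall v : 'cV[C]_d, 0 <= (v^t* *m A *m v) 0 0.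

Definition state rho : Prop := psdmx rho /\ \tr rho = 1.

Definition pure_state rho : Prop := state rho /\ \rank rho = 1%N.

Definition tau : 'M[C]_d := (d%:R^-1)%:M.

(* f(A) for Hermitian A: f is applied to the eigenvalues of A, which are real,
   in an orthonormal eigenbasis. *)
Definition mx_fun (f : R -> R) A : 'M[C]_d :=
  invmx (spectralmx A)
    *m diag_mx (map_mx (fun z : C => (f (complex.Re z))%:C) (spectral_diag A))
    *m spectralmx A.

Definition mx_abs A : 'M[C]_d := mx_fun Num.sqrt (A^t* *m A).

Definition trace_norm A : R := complex.Re (\tr (mx_abs A)).

Definition trace_ball eps sigma : set 'M[C]_d :=
  [set omega | state omega /\ 2^-1 * trace_norm (omega - sigma) <= eps].

(* ln 0 = 0 in the library, hence log2 0 = 0, which implements 0 log 0 = 0. *)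
Definition entropy rho : R := - complex.Re (\tr (rho *m mx_fun log2 rho)).

Definition binary_entropy eps : R :=
  - (eps * log2 eps) - (1 - eps) * log2 (1 - eps).

(* An orthonormal basis |1>, ..., |d> is given by the columns of a unitary
   matrix U. Spectra are 1-based: p k is the coefficient of |k><k| for
   1 <= k <= d, and the values of p outside this range are irrelevant. *)
Definition ket U (i : 'I_d) : 'cV[C]_d := col i U.

Definition diag_in U p : 'M[C]_d :=
  \sum_(i < d) (p i.+1)%:C *: (ket U i *m (ket U i)^t*).

Definition eigendecomposition sigma U mu : Prop :=
  [/\ U \is unitarymx, sigma = diag_in U mu &
      forall i j : nat, (1 <= i)%N -> (i <= j)%N -> (j <= d)%N -> mu j <= mu i].

(* For a state sigma at trace distance more than eps from tau, these two sets
   are singletons. *)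
Definition low_level eps mu : set (R * nat) :=
  [set an | let: (a, n) := an in
    [/\ 0 <= a <= 1, (1 <= n <= d - 1)%N,
        \sum_(d - n + 1 <= i < d.+1) `|a - mu i| = eps &
        mu (d - n + 1)%N < a <= mu (d - n)%N]].

Definition high_level eps mu : set (R * nat) :=
  [set am | let: (a, m) := am in
    [/\ 0 <= a <= 1, (1 <= m <= d - 1)%N,
        \sum_(1 <= i < m.+1) `|a - mu i| = eps &
        mu (m + 1)%N <= a < mu m]].

Definition rho_upper eps sigma U mu : 'M[C]_d :=
  if 2^-1 * trace_norm (sigma - tau) <= eps then tau
  else
    let: (a1, n) := xget (0, 0%N) (low_level eps mu) in
    let: (a2, m) := xget (0, 0%N) (high_level eps mu) in
    diag_in U (fun i : nat =>
      if (i <= m)%N then a2 else if (i <= d - n)%N then mu i else a1).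

Definition tail_sum q (l : nat) : R := \sum_(d - l + 1 <= j < d.+1) q j.

Definition tail_index eps q : nat :=
  \max_(l < d | (0 < l)%N && (tail_sum q l <= eps)) l.

Definition lower_spectrum eps q : nat -> R := fun j =>
  if eps < q d then
    if j == 1%N then q 1%N + eps else if j == d then q d - eps else q j
  else
    let l := tail_index eps q in
    if l == (d - 1)%N then (if j == 1%N then 1 else 0)
    else if j == 1%N then q 1%N + eps
    else if (j <= d - l - 1)%N then q j
    else if j == (d - l)%N then q (d - l)%N - (eps - tail_sum q l)
    else 0.

Definition rho_lower eps U mu : 'M[C]_d := diag_in U (lower_spectrum eps mu).

Definition uniform_bound eps : R :=
  if eps < 1 - d%:R^-1
  then eps * log2 (d - 1)%:R + binary_entropy eps
  else log2 d%:R.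

Definition pure_spectrum : nat -> R := fun i => if i == 1%N then 1 else 0.

Definition spread_spectrum eps : nat -> R := fun i =>
  if i == 1%N then 1 - eps else eps / (d - 1)%:R.

End QuantumStates.
Arguments tau {R d}.
Arguments pure_spectrum {R}.

(* Main.v *)
Require Import Defs.
From mathcomp Require Import all_boot all_order all_algebra.
From mathcomp Require Import all_classical all_reals all_analysis.
From mathcomp Require Import perm lra ring zify.
Set Implicit Arguments.
Unset Strict Implicit.
Unset Printing Implicit Defensive.
Import Order.TTheory GRing.Theory Num.Theory.
Local Open Scope ring_scope.
Local Open Scope complex_scope.
Local Open Scope classical_set_scope.

(** For a state [omega] in the ball around [sigma] and a projection [P], the traces
    of [P omega] and [P sigma] differ by at most [eps].  Taking for [P] the projections
    onto leading eigenvectors of [sigma], and [-log rho_up] as a test operator in Klein's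
    inequality [S(omega) <= -Tr(omega log rho_up)], an Abel summation gives
    [S(omega) <= S(rho_up)]: the spectrum of [rho_up] only decreases at ranks where its
    partial sums are those of [sigma] minus [eps].  Taking leading eigenvectors of
    [omega] instead, the spectrum of [omega] is majorized by the one of [rho_low], whence
    [S(rho_low) <= S(omega)].

    Both gaps compare commuting states at trace distance at most [eps], that is two
    probability vectors [p] and [q] with a coupling [t] of off-diagonal mass at most
    [eps].  With [f i j] equal to [1 - eps] for [i = j] and to [eps / (d - 1)]
    otherwise, each term obeys
    [t i j (ln (q j) - ln (p i)) <= - t i j ln (f i j) + q j f i j - t i j],
    and summing gives Fano's bound.  In the equality case every term is tight, so
    [t i j = q j f i j] and [t i j] is [0] or [p i]; then any [j] with [q j > 0]
    carries all the mass of [q], and [p = f _ j]. *)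

(** * Entropies of finite real sequences *)

Section RealLemmas.
Variable R : realType.

Lemma ln_le_subr1 (x : R) : 0 < x -> ln x <= x - 1.
Proof.
move=> x0; by have := @le_ln1Dx R (x - 1); rewrite subrKC; apply; lra.
Qed.

Lemma ln_lt_subr1 (x : R) : 0 < x -> x != 1 -> ln x < x - 1.
Proof.
move=> x0 x1; rewrite -ltr_expR lnK ?posrE//.
have := @expR_gt1Dx R (x - 1); rewrite subr_eq0 subrKC; exact.
Qed.

Lemma gibbs_term (p r : R) : 0 <= p -> 0 < r ->
  - (p * ln p) <= - (p * ln r) + (r - p).
Proof.
rewrite le_eqVlt => /predU1P[<- r0|p0 r0]; first by rewrite !mul0r; lra.
have := ln_le_subr1 (divr_gt0 r0 p0); rewrite ln_div ?posrE// -(ler_pM2l p0).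
rewrite !mulrBr mulrCA divff ?gt_eqF//; lra.
Qed.

Lemma gibbs_term_eq (p r : R) : 0 <= p -> 0 < r ->
  - (p * ln p) = - (p * ln r) + (r - p) -> p = r.
Proof.
rewrite le_eqVlt => /predU1P[<- r0|p0 r0]; first by rewrite !mul0r; lra.
have [<-//|pr] := eqVneq p r.
have := @ln_lt_subr1 (r / p) (divr_gt0 r0 p0).
rewrite -subr_eq0 -[X in _ - X](divff (negbT (gt_eqF p0))) -mulrBl mulf_eq0.
rewrite invr_eq0 (gt_eqF p0) orbF subr_eq0 eq_sym => /(_ pr).
rewrite ln_div ?posrE// -(ltr_pM2l p0) !mulrBr mulrCA divff ?gt_eqF//; lra.
Qed.

Lemma eq_sum_le (I : finType) (a b : I -> R) :
  (forall i, a i <= b i) -> \sum_i a i = \sum_i b i -> forall i, a i = b i.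
Proof.
move=> ab e i; have t j : true -> 0 <= b j - a j by rewrite subr_ge0 ab.
have /(psumr_eq0P t) /(_ i isT) : \sum_j (b j - a j) = 0.
  by rewrite sumrB e subrr.
by move/eqP; rewrite subr_eq0 => /eqP.
Qed.

(** Measured in nats; the factor [ln 2] enters in [entropy_udiag]. *)
Definition shannon d (p : 'I_d -> R) := - \sum_i p i * ln (p i).

Lemma gibbs d (p r : 'I_d -> R) : (forall i, 0 <= p i) -> (forall i, 0 < r i) ->
  \sum_i p i = \sum_i r i -> shannon p <= - \sum_i p i * ln (r i).
Proof.
move=> p0 r0 pr; rewrite /shannon -!sumrN.
have -> : \sum_i - (p i * ln (r i)) = \sum_i (- (p i * ln (r i)) + (r i - p i)).
  by rewrite big_split/= sumrB pr subrr addr0.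
by apply: ler_sum => i _; exact: gibbs_term.
Qed.

Lemma gibbs_eq d (p r : 'I_d -> R) :
  (forall i, 0 <= p i) -> (forall i, 0 < r i) ->
  \sum_i p i = \sum_i r i -> shannon p = - \sum_i p i * ln (r i) ->
  forall i, p i = r i.
Proof.
move=> p0 r0 pr e i; apply: gibbs_term_eq => //.
apply: (@eq_sum_le _ (fun i => - (p i * ln (p i)))
  (fun i => - (p i * ln (r i)) + (r i - p i))) => [j|].
  exact: gibbs_term.
by rewrite big_split/= sumrB pr subrr addr0 !sumrN.
Qed.

Lemma shannon_ge0 d (p : 'I_d -> R) : (forall i, 0 <= p i <= 1) ->
  0 <= shannon p.
Proof.
move=> p01; rewrite /shannon -sumrN; apply: sumr_ge0 => i _.
have /andP[p0 p1] := p01 i.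
by rewrite -mulrN mulr_ge0// oppr_ge0 ln_le0.
Qed.

Lemma shannon_eq0 d (p : 'I_d -> R) : (forall i, 0 <= p i <= 1) ->
  shannon p = 0 -> forall i, p i = 0 \/ p i = 1.
Proof.
move=> p01 e i; have /andP[p0 p1] := p01 i.
have : - (p i * ln (p i)) = 0.
  apply/esym; apply: (@eq_sum_le _ (fun=> 0) (fun i => - (p i * ln (p i)))) => [j|].
    have /andP[q0 q1] := p01 j.
    by rewrite -mulrN mulr_ge0// oppr_ge0 ln_le0.
  by rewrite sumrN big1.
move/eqP; rewrite oppr_eq0 mulf_eq0 => /orP[/eqP|]; first by left.
move: p0; rewrite le_eqVlt => /predU1P[<-|p0]; first by left.
by rewrite ln_eq0// => /eqP; right.
Qed.

(** Klein's inequality without matrices: [D] will hold the squared overlaps of two eigenbases. The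
    scalar inequality for [l j] and [r i] is weighted by [D i j]; the corrections [r i - l j] cancel
    because rows and columns of [D] sum to one and the totals agree. *)
Lemma gibbs_bistochastic d (D : 'I_d -> 'I_d -> R) (l r : 'I_d -> R) :
  (forall i j, 0 <= D i j) ->
  (forall i, \sum_j D i j = 1) -> (forall j, \sum_i D i j = 1) ->
  (forall i, 0 <= l i) -> (forall i, 0 < r i) -> \sum_i l i = \sum_i r i ->
  shannon l <= - \sum_i (\sum_j D i j * l j) * ln (r i).
Proof.
move=> D0 Dr Dc l0 r0 lr.
have -> : shannon l = \sum_i \sum_j D i j * - (l j * ln (l j)).
  rewrite exchange_big/= /shannon -sumrN; apply: eq_bigr => j _.
  by rewrite -mulr_suml Dc mul1r.
have -> : - \sum_i (\sum_j D i j * l j) * ln (r i) =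
    \sum_i \sum_j D i j * (- (l j * ln (r i)) + (r i - l j)).
  under [RHS]eq_bigr do under eq_bigr do rewrite mulrDr mulrBr.
  under [RHS]eq_bigr do rewrite big_split/= sumrB.
  rewrite big_split/= sumrB.
  have -> : \sum_i \sum_j D i j * r i = \sum_i r i.
    by apply: eq_bigr => i _; rewrite -mulr_suml Dr mul1r.
  have -> : \sum_i \sum_j D i j * l j = \sum_i l i.
    rewrite exchange_big/=.
    by apply: eq_bigr => i _; rewrite -mulr_suml Dc mul1r.
  rewrite lr subrr addr0 -sumrN; apply: eq_bigr => i _.
  by rewrite mulr_suml -sumrN; apply: eq_bigr => j _; rewrite mulrN mulrA.
do 2!(apply: ler_sum => ? _).
by apply: ler_wpM2l => //; exact: gibbs_term.
Qed.

Lemma abel_sum (x g : nat -> R) n :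
  \sum_(i < n.+1) x i * g i =
  (\sum_(i < n.+1) x i) * g n
  - \sum_(k < n) (\sum_(i < k.+1) x i) * (g k.+1 - g k).
Proof.
elim: n => [|n IH]; first by rewrite !big_ord1 big_ord0 subr0.
rewrite big_ord_recr/= IH [in RHS]big_ord_recr/=.
rewrite [X in _ = _ - X]big_ord_recr/=; ring.
Qed.

Definition psum d (x : 'I_d -> R) k := \sum_(i < d | (i < k)%N) x i.

Lemma psum0 d (x : 'I_d -> R) : psum x 0 = 0.
Proof. by rewrite /psum big_pred0. Qed.

Lemma psumB d (x y : 'I_d -> R) k :
  psum (fun i => x i - y i) k = psum x k - psum y k.
Proof. exact: sumrB. Qed.

Lemma psumE d (x : nat -> R) k : (k <= d)%N ->
  psum (fun i : 'I_d => x i) k = \sum_(i < k) x i.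
Proof. by move=> kd; rewrite (big_ord_widen _ _ kd). Qed.

(** Abel summation leaves products of a prefix sum of [x] with an increment of [g]. The sign of a
    prefix sum matters only where [g] strictly increases, which is what a spectrum with plateaus
    provides. *)
Lemma abel_le0 d (x g : 'I_d -> R) : \sum_i x i = 0 ->
  (forall i j : 'I_d, j = i.+1 :> nat ->
    g i <= g j /\ (g i < g j -> 0 <= psum x j)) ->
  \sum_i x i * g i <= 0.
Proof.
case: d x g => [|n] x g x0 H; first by rewrite big_ord0.
pose x' k := x (inord k); pose g' k := g (inord k).
have -> : \sum_i x i * g i = \sum_(i < n.+1) x' i * g' i.
  by apply: eq_bigr => i _; rewrite /x' /g' inord_val.
have x'0 : \sum_(i < n.+1) x' i = 0.
  by rewrite -[RHS]x0; apply: eq_bigr => i _; rewrite /x' inord_val.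
rewrite abel_sum x'0 mul0r sub0r oppr_le0; apply: sumr_ge0 => k _.
have kn : (k.+1 < n.+1)%N by rewrite ltnS.
have [|gg X] := H (inord k) (inord k.+1).
  by rewrite !inordK// ltnW.
rewrite -/(g' k) -/(g' k.+1) in gg X.
move: gg; rewrite le_eqVlt => /predU1P[->|gg]; first by rewrite subrr mulr0.
rewrite mulr_ge0 ?subr_ge0 ?(ltW gg)//.
move: (X gg); rewrite inordK// -(@psumE n.+1 x')//; last exact: ltnW.
by congr (_ <= _); apply: eq_bigr => i _; rewrite /x' inord_val.
Qed.

(** Gibbs' inequality bounds [shannon p] by its cross entropy relative to [l]; since [- ln l]
    increases along the sequence, Abel summation bounds this by [shannon l]. *)
Lemma karamata_shannon d (l p : 'I_d -> R) :
  (forall i j : 'I_d, (i <= j)%N -> l j <= l i) ->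
  (forall i, 0 <= l i) -> (forall i, 0 <= p i) ->
  \sum_i l i = \sum_i p i ->
  (forall k, (k < d)%N -> psum l k <= psum p k) ->
  shannon p <= shannon l.
Proof.
move=> ldec l0 p0 lp maj.
(* As [l] decreases, a zero at [j] means that the entries before [j] carry all the mass;
   majorization then leaves none for [p j]. *)
have p_eq0 j : l j = 0 -> p j = 0.
  move=> lj0; have := maj j (ltn_ord j).
  have -> : psum l j = \sum_i p i.
    rewrite -lp [RHS](bigID (fun i : 'I_d => (i < j)%N))/=.
    rewrite [X in _ = _ + X]big1 ?addr0// => i; rewrite -leqNgt => ji.
    by apply/eqP; rewrite eq_le l0 andbT -lj0 ldec.
  rewrite [X in X <= _](bigID (fun i : 'I_d => (i < j)%N))/= -/(psum p j).
  rewrite (bigD1 j) ?ltnn//=.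
  set s := \sum_(i < d | _) _; have s0 : 0 <= s by apply: sumr_ge0.
  by have := p0 j; lra.
(* [- ln (l j)] should be infinite at a zero of [l], whereas [ln 0 = 0]. The large value [B] put
   there keeps the weights [g] increasing and is only ever multiplied by zero. *)
pose B := \sum_i `|ln (l i)|.
pose g j := if l j == 0 then B else - ln (l j).
have gB j : - ln (l j) <= B.
  apply: le_trans (ler_norm _) _; rewrite normrN /B (bigD1 j)//= lerDl.
  exact: sumr_ge0.
have -> : shannon l = \sum_i (l i * g i).
  rewrite /shannon -sumrN; apply: eq_bigr => i _; rewrite /g.
  by case: eqP => [->|_]; rewrite ?mul0r ?oppr0// mulrN.
have main : shannon p <= \sum_i (p i * g i + (l i - p i)).
  rewrite /shannon -sumrN; apply: ler_sum => i _; rewrite /g.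
  case: eqP => [li|/eqP li]; first by rewrite (p_eq0 _ li) li !mul0r; lra.
  by rewrite mulrN gibbs_term// lt_neqAle eq_sym li l0.
apply: le_trans main _; rewrite big_split/= sumrB lp subrr addr0 -subr_le0 -sumrB.
under eq_bigr do rewrite -mulrBl.
apply: (@abel_le0 _ (fun i => p i - l i)) => [|i j ji].
  by rewrite sumrB lp subrr.
split=> [|_]; last by rewrite psumB subr_ge0 maj.
have lji : l j <= l i by rewrite ldec// ji.
rewrite /g; case: eqP => [li0|/eqP li0].
  case: eqP => // lj0; exfalso; apply: lj0.
  by apply/eqP; rewrite eq_le l0 -li0 lji.
case: eqP => // /eqP lj0; rewrite lerN2 ler_ln ?posrE//.
  by rewrite lt_neqAle eq_sym lj0 l0.
by rewrite lt_neqAle eq_sym li0 l0.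
Qed.

(** Both weightings have total [k], so the threshold [t] can be subtracted from [m] at no cost. Then
    [c] lowers the weight of entries above [t] and raises that of entries below it. *)
Lemma sum_weights_le_psum d (c m : 'I_d -> R) k : (k < d)%N ->
  (forall i j : 'I_d, (i <= j)%N -> m j <= m i) ->
  (forall i, 0 <= c i <= 1) -> \sum_i c i = k%:R ->
  \sum_i c i * m i <= psum m k.
Proof.
move=> kd mdec c01 ck; pose t := m (Ordinal kd).
have -> : psum m k = \sum_(i < d) (i < k)%N%:R * m i.
  rewrite /psum big_mkcond; apply: eq_bigr => i _.
  by case: ifP; rewrite ?mul1r ?mul0r.
have kE : \sum_(i < d) (i < k)%N%:R = k%:R :> R.
  rewrite -[in RHS](card_ord k) -[RHS]sumr_const.
  rewrite (big_ord_widen _ (fun=> 1) (ltnW kd)) [RHS]big_mkcond/=.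
  by apply: eq_bigr => i _; case: ifP.
have : \sum_(i < d) (c i - (i < k)%N%:R) * (m i - t) <= 0.
  apply: sumr_le0 => i _; have /andP[c0 c1] := c01 i.
  case: (ltnP i k) => ik.
    by rewrite mulr_le0_ge0 ?subr_le0 ?subr_ge0// mdec// ltnW.
  by rewrite subr0 mulr_ge0_le0// subr_le0 mdec.
under eq_bigr do rewrite mulrBr mulrBl.
by rewrite !sumrB -mulr_suml sumrB ck kE subrr mul0r subr0 subr_le0.
Qed.

(** As [x] sums to zero, the weights may be shifted by [1/2], which makes them at most [1/2] in
    modulus. *)
Lemma sum_weights_le_half_norm (I : finType) (e x : I -> R) :
  (forall i, 0 <= e i <= 1) -> \sum_i x i = 0 ->
  `|\sum_i e i * x i| <= 2^-1 * \sum_i `|x i|.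
Proof.
move=> e01 x0.
have -> : \sum_i e i * x i = \sum_i (e i - 2^-1) * x i.
  under [RHS]eq_bigr do rewrite mulrBl.
  by rewrite sumrB -mulr_sumr x0 mulr0 subr0.
apply: le_trans (ler_norm_sum _ _ _) _; rewrite mulr_sumr.
apply: ler_sum => i _; rewrite normrM ler_wpM2r// ler_norml.
by have := e01 i; lra.
Qed.

Lemma half_norm_sum (I : finType) (x : I -> R) : \sum_i x i = 0 ->
  2^-1 * \sum_i `|x i| = \sum_i Num.max (x i) 0.
Proof.
move=> x0; have -> : \sum_i Num.max (x i) 0 = \sum_i (Num.max (x i) 0 - 2^-1 * x i).
  by rewrite sumrB -[X in _ = _ - X]mulr_sumr x0 mulr0 subr0.
rewrite mulr_sumr.
apply: eq_bigr => i _; case: (leP (x i) 0) => xi.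
  by rewrite ler0_norm//; lra.
by rewrite gtr0_norm//; lra.
Qed.

End RealLemmas.

(** * Fano's inequality for two probability vectors, with its equality case *)

Section Fano.
Variable R : realType.

Lemma fano_term (t a b f : R) : 0 <= t -> t <= a -> t <= b -> 0 < f ->
  t * (ln b - ln a) <= - (t * ln f) + (b * f - t).
Proof.
rewrite le_eqVlt => /predU1P[<-|t0] ta tb f0.
  by rewrite !mul0r !oppr0 add0r addr0 mulr_ge0// ltW.
have b0 : 0 < b by lra.
have := gibbs_term (ltW t0) (mulr_gt0 b0 f0).
rewrite lnM ?posrE//.
have : t * ln t <= t * ln a by rewrite ler_pM2l// ler_ln ?posrE//; lra.
lra.
Qed.

Lemma fano_term_eq (t a b f : R) : 0 <= t -> t <= a -> t <= b -> 0 < f ->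
  t * (ln b - ln a) = - (t * ln f) + (b * f - t) ->
  t = b * f /\ (t = 0 \/ t = a).
Proof.
rewrite le_eqVlt => /predU1P[<-|t0] ta tb f0.
  by rewrite !mul0r !oppr0 add0r addr0 => ->; split=> //; left.
have b0 : 0 < b by lra.
have g := gibbs_term (ltW t0) (mulr_gt0 b0 f0).
have ge := gibbs_term_eq (ltW t0) (mulr_gt0 b0 f0).
rewrite lnM ?posrE// in g ge.
have la : t * ln t <= t * ln a by rewrite ler_pM2l// ler_ln ?posrE//; lra.
move=> e; split; first by apply: ge; lra.
right; apply: (@ln_inj R); rewrite ?posrE//; first lra.
by apply: (mulfI (lt0r_neq0 t0)); lra.
Qed.

Lemma sum_delta d (i : 'I_d) (F : 'I_d -> R) :
  \sum_j (i == j)%:R * F j = F i.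
Proof.
rewrite (bigD1 i)//= eqxx mul1r big1 ?addr0// => j.
by rewrite eq_sym => /negbTE ->; rewrite mul0r.
Qed.

(** The common part of [p] and [q] stays on the diagonal, and the surplus [u] of [p] is distributed
    over the deficits [v] in proportion. The second part adds nothing to the diagonal, since [u i]
    and [v i] are never both positive. *)
Lemma maximal_coupling d (p q : 'I_d -> R) :
  (forall i, 0 <= p i) -> (forall i, 0 <= q i) -> \sum_i p i = \sum_i q i ->
  exists t : 'I_d -> 'I_d -> R,
  [/\ forall i j, 0 <= t i j,
      forall i, \sum_j t i j = p i,
      forall j, \sum_i t i j = q j &
      \sum_i t i i = \sum_i p i - 2^-1 * \sum_i `|p i - q i|].
Proof.
move=> p0 q0 pq.
pose u i := Num.max (p i - q i) 0; pose v i := Num.max (q i - p i) 0.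
pose D := \sum_i u i.
have DE : D = 2^-1 * \sum_i `|p i - q i|.
  by rewrite (half_norm_sum (x := fun i => p i - q i))// sumrB pq subrr.
have vD : \sum_i v i = D.
  rewrite DE; under [in RHS]eq_bigr do rewrite distrC.
  by rewrite (half_norm_sum (x := fun i => q i - p i))// sumrB pq subrr.
have u0 i : 0 <= u i by rewrite le_max lexx orbT.
have v0 i : 0 <= v i by rewrite le_max lexx orbT.
have D0 : 0 <= D by exact: sumr_ge0.
(* When [D = 0] the quotient is zero by convention, and so is every [w i]. *)
have cancel (w : 'I_d -> R) : (forall i, 0 <= w i) -> \sum_i w i = D ->
    forall i, w i * D / D = w i.
  move=> w0 wD i; have [Dz|Dn] := eqVneq D 0; last by rewrite mulfK.
  have := @psumr_eq0P _ _ xpredT w (fun j _ => w0 j).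
  by rewrite wD => /(_ Dz i isT) ->; rewrite !mul0r.
exists (fun i j => (i == j)%:R * Num.min (p i) (q i) + u i * v j / D); split.
- move=> i j; rewrite addr_ge0 ?mulr_ge0 ?invr_ge0//.
  by rewrite le_min p0 q0.
- move=> i; rewrite big_split/= (sum_delta i (fun=> Num.min (p i) (q i))).
  rewrite -mulr_suml -mulr_sumr vD cancel// /u.
  by case: (leP (p i - q i) 0) => ?; case: (leP (p i) (q i)) => ?; lra.
- move=> j; rewrite big_split/=.
  under eq_bigr do rewrite eq_sym.
  rewrite (sum_delta j (fun i => Num.min (p i) (q i))).
  rewrite -mulr_suml -mulr_suml -/D [D * _]mulrC cancel// /v.
  by case: (leP (q j - p j) 0) => ?; case: (leP (p j) (q j)) => ?; lra.
- rewrite -DE /D -sumrB; apply: eq_bigr => i _.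
  rewrite eqxx mul1r /u /v.
  by case: (leP (p i - q i) 0) => ?; case: (leP (q i - p i) 0) => ?;
    case: (leP (p i) (q i)) => ?; rewrite ?(mul0r, mulr0); lra.
Qed.

(** The entropy of [(1 - e, e/(d-1), ..., e/(d-1))], that is [h(e) + e ln(d-1)] in nats. *)
Definition fano_bound d (e : R) :=
  - ((1 - e) * ln (1 - e)) - e * ln (e / (d - 1)%:R).

Lemma fano_ratio_gt0 d (e : R) : (2 <= d)%N -> 0 < e -> 0 < e / (d - 1)%:R.
Proof. by move=> d2 e0; rewrite divr_gt0// ltr0n subn_gt0. Qed.

Lemma natr_subn1 d : (2 <= d)%N -> (d - 1)%:R = d%:R - 1 :> R.
Proof. by move=> d2; rewrite natrB// ltnW. Qed.

Lemma fano_ratio_lt d (e : R) : (2 <= d)%N -> e < 1 - d%:R^-1 ->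
  e / (d - 1)%:R < 1 - e.
Proof.
move=> d2 ed; have d0 : 2 <= d%:R :> R by rewrite ler_nat.
rewrite natr_subn1// ltr_pdivrMr; last lra.
have d00 : 0 < d%:R :> R by lra.
move: ed; rewrite -(ltr_pM2r d00) mulrBl mulVf ?gt_eqF// mul1r; lra.
Qed.

Lemma sum_fano d (e : R) (j : 'I_d) : (2 <= d)%N ->
  \sum_i (if i == j then 1 - e else e / (d - 1)%:R) = 1.
Proof.
move=> d2; rewrite (bigD1 j)//= eqxx.
under eq_bigr => i /negbTE -> do [].
rewrite sumr_const cardC1 card_ord -subn1 -[_ *+ _]mulr_natr divfK; first lra.
by rewrite pnatr_eq0 subn_eq0 -ltnNge.
Qed.

Section Bound.
Variables (d : nat) (p q : 'I_d -> R) (e : R).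
Hypotheses (d2 : (2 <= d)%N) (p0 : forall i, 0 <= p i) (q0 : forall i, 0 <= q i).
Hypotheses (p1 : \sum_i p i = 1) (q1 : \sum_i q i = 1).
Hypothesis pq : 2^-1 * \sum_i `|p i - q i| <= e.
Hypotheses (e0 : 0 < e) (ed : e < 1 - d%:R^-1).

Let f (i j : 'I_d) := if i == j then 1 - e else e / (d - 1)%:R.

Let f0 i j : 0 < f i j.
Proof.
rewrite /f; case: eqP => _; last exact: fano_ratio_gt0.
exact: lt_trans (fano_ratio_gt0 d2 e0) (fano_ratio_lt d2 ed).
Qed.

(* Fano's inequality for the maximal coupling [t] of [p] and [q], in the form of
   term-by-term bounds whose sum is [fano_bound d e]. *)
Let fano_terms : exists t : 'I_d -> 'I_d -> R,
  [/\ forall i j, [/\ 0 <= t i j, t i j <= p i & t i j <= q j],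
      shannon p - shannon q = \sum_i \sum_j t i j * (ln (q j) - ln (p i)) &
      \sum_i \sum_j (- (t i j * ln (f i j)) + (q j * f i j - t i j))
        <= fano_bound d e].
Proof.
have [t [t0 tp tq tD]] : exists t : 'I_d -> 'I_d -> R,
  [/\ forall i j, 0 <= t i j, forall i, \sum_j t i j = p i,
      forall j, \sum_i t i j = q j &
      \sum_i t i i = \sum_i p i - 2^-1 * \sum_i `|p i - q i|].
  by apply: maximal_coupling => //; rewrite p1 q1.
exists t; split=> [i j||].
- split=> //.
    by rewrite -tp (bigD1 j)//= lerDl; exact: sumr_ge0.
  by rewrite -tq (bigD1 i)//= lerDl; exact: sumr_ge0.
- under eq_bigr do under eq_bigr do rewrite mulrBr.
  under eq_bigr do rewrite sumrB.
  rewrite sumrB exchange_big/= /shannon opprK addrC; congr (_ - _).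
    by apply: eq_bigr => j _; rewrite -mulr_suml tq.
  by apply: eq_bigr => j _; rewrite -mulr_suml tp.
(* [ln (f i j)] is [a] on the diagonal and [b] off it, so the sum depends on [t] only through its
   diagonal mass. That mass is at least [1 - e], and [b <= a] makes [1 - e] the worst case. *)
- pose a := ln (1 - e); pose b := ln (e / (d - 1)%:R).
  have ab : b <= a.
    have r0 := fano_ratio_gt0 d2 e0; have r1 := fano_ratio_lt d2 ed.
    by rewrite ler_ln ?posrE// ?(lt_trans r0 r1)// ltW.
  have -> : \sum_i \sum_j (- (t i j * ln (f i j)) + (q j * f i j - t i j)) =
      - b - (a - b) * \sum_i t i i.
    under eq_bigr do rewrite big_split/= sumrB sumrN.
    rewrite big_split/= sumrB sumrN.
    have -> : \sum_i \sum_j q j * f i j = 1.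
      rewrite exchange_big/= -[RHS]q1; apply: eq_bigr => j _.
      by rewrite -mulr_sumr sum_fano// mulr1.
    have -> : \sum_i \sum_j t i j = 1.
      by rewrite -[RHS]p1; apply: eq_bigr => i _; rewrite tp.
    have -> : \sum_i \sum_j t i j * ln (f i j) = b + (a - b) * \sum_i t i i.
      rewrite -[X in X + _]mul1r -p1 mulr_suml mulr_sumr -big_split/=.
      apply: eq_bigr => i _; rewrite -(sum_delta i (t i)) -(tp i).
      rewrite mulr_suml mulr_sumr -big_split/=; apply: eq_bigr => j _.
      by rewrite /f -/a -/b; case: eqP => _ /=; rewrite -?/a -?/b; ring.
    by ring.
  rewrite tD p1 /fano_bound -/a -/b.
  have : 0 <= (a - b) * (e - 2^-1 * \sum_i `|p i - q i|).
    by rewrite mulr_ge0// subr_ge0.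
  lra.
Qed.

Lemma fano_le : shannon p - shannon q <= fano_bound d e.
Proof.
have [t [tpq -> tb]] := fano_terms; apply: le_trans tb.
apply: ler_sum => i _; apply: ler_sum => j _.
have [? ? ?] := tpq i j; exact: fano_term.
Qed.

Lemma fano_eq : shannon p - shannon q = fano_bound d e ->
  exists j, forall i, q i = (i == j)%:R /\ p i = f i j.
Proof.
have [t [tpq -> tb]] := fano_terms => eb.
have tle i j : t i j * (ln (q j) - ln (p i)) <=
    - (t i j * ln (f i j)) + (q j * f i j - t i j).
  have [? ? ?] := tpq i j; exact: fano_term.
have sle i : \sum_j t i j * (ln (q j) - ln (p i)) <=
    \sum_j (- (t i j * ln (f i j)) + (q j * f i j - t i j)).
  by apply: ler_sum => j _.
have se : \sum_i \sum_j t i j * (ln (q j) - ln (p i)) =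
    \sum_i \sum_j (- (t i j * ln (f i j)) + (q j * f i j - t i j)).
  apply/eqP; rewrite eq_le; apply/andP; split; first by apply: ler_sum => i _.
  by rewrite eb.
have te i j := eq_sum_le (tle i) (eq_sum_le sle se i) j.
have tf i j : t i j = q j * f i j /\ (t i j = 0 \/ t i j = p i).
  have [? ? ?] := tpq i j; exact: fano_term_eq (te i j).
have [j qj] : exists j, q j != 0.
  apply/existsP; rewrite -negb_forall; apply/negP => /forallP qz.
  have /eqP := q1; rewrite big1 ?(eq_sym 0) ?oner_eq0// => i _.
  exact/eqP/qz.
(* [t i j = q j * f i j] is nonzero, which leaves [t i j = p i]; summing over [i] then gives
   [q j = 1]. *)
have pE i : p i = q j * f i j.
  have [tE [tz|<-//]] := tf i j.
  move: tE; rewrite tz => /esym/eqP; rewrite mulf_eq0 (negbTE qj)/=.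
  by rewrite gt_eqF.
have qj1 : q j = 1.
  by rewrite -[RHS]p1 (eq_bigr _ (fun i _ => pE i)) -mulr_sumr sum_fano// mulr1.
exists j => i; split; last by rewrite pE qj1 mul1r.
have [->//|ij] := eqVneq i j.
have := q1; rewrite (bigD1 j)//= qj1 => s1.
have s0 : \sum_(i < d | i != j) q i = 0 by lra.
have := @psumr_eq0P R _ (fun i => i != j) q (fun i _ => q0 i) s0.
exact.
Qed.

End Bound.
End Fano.

(** * Cutting the top of a decreasing sequence down to a level *)

Section LevelExistence.
Variables (R : realType) (d : nat) (nu : nat -> R) (c eps : R).
Hypotheses (d2 : (2 <= d)%N) (eps0 : 0 < eps).
Hypothesis nu_dec :
  forall i j, (1 <= i)%N -> (i <= j)%N -> (j <= d)%N -> nu j <= nu i.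
Hypothesis mean : \sum_(1 <= i < d.+1) nu i = d%:R * c.
Hypothesis excess : eps < \sum_(1 <= i < d.+1) Num.max (nu i - c) 0.

Let sum_nu_sub m (a : R) :
  \sum_(1 <= i < m.+1) (nu i - a) = \sum_(1 <= i < m.+1) nu i - m%:R * a.
Proof. by rewrite sumrB sumr_const_nat subn1/= mulr_natl. Qed.

Lemma last_le_mean : nu d <= c.
Proof.
have d0 : 0 < d%:R :> R by rewrite ltr0n ltnW.
rewrite -(ler_pM2l d0) -mean.
have -> : d%:R * nu d = \sum_(1 <= i < d.+1) nu d.
  by rewrite sumr_const_nat subn1 mulr_natl.
by apply: ler_sum_nat => i /andP[i1 id]; rewrite nu_dec.
Qed.

(** [F m] is the mass removed when the first [m] entries are cut to the height of the next one; [m]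
    is taken least with [eps <= F m]. *)
Lemma level_exists : exists a m, [/\ (1 <= m <= d - 1)%N,
  \sum_(1 <= i < m.+1) (nu i - a) = eps & nu m.+1 <= a < nu m].
Proof.
pose F m := \sum_(1 <= i < m.+1) (nu i - nu m.+1).
(* Cutting at [nu d], which is at most the mean [c], removes at least the excess over [c]. *)
have Fd : eps <= F (d - 1)%N.
  rewrite /F subn1 prednK 1?ltnW//; move: excess.
  rewrite big_nat_recr/=; last by rewrite ltnW.
  move/ltW/le_trans; apply.
  have /max_idPr -> : nu d - c <= 0 by rewrite subr_le0 last_le_mean.
  rewrite addr0; apply: ler_sum_nat => i /andP[i1 id].
  have nud : nu d <= nu i by rewrite nu_dec// ltnW.
  have ndc := last_le_mean; rewrite ge_max; apply/andP; split; lra.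
have exF : exists m, eps <= F m by exists (d - 1)%N.
case: (ex_minnP exF) => m Fm mmin.
have m0 : (0 < m)%N.
  by case: m Fm {mmin} => // ; rewrite /F big_geq// leNgt eps0.
have md : (m <= d - 1)%N by exact: mmin.
have mR : 0 < m%:R :> R by rewrite ltr0n.
(* The level solves the equation for the removed mass; [eps <= F m] bounds it from below, and
   [F m.-1 < eps], from minimality, bounds it from above. *)
exists ((\sum_(1 <= i < m.+1) nu i - eps) / m%:R), m; split.
- by rewrite m0.
- by rewrite sum_nu_sub mulrC divfK ?gt_eqF//; lra.
- rewrite ler_pdivlMr// ltr_pdivrMr//; apply/andP; split.
    by move: Fm; rewrite /F sum_nu_sub mulrC; lra.
  have : F m.-1 < eps.
    by rewrite ltNge; apply/negP => /mmin; rewrite leqNgt prednK// leqnn.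
  (* Adding the zero term [nu m - nu m] turns [F m.-1] into a sum of [m] terms. *)
  rewrite /F prednK// -[X in X < _]addr0 -[X in _ + X](subrr (nu m)).
  rewrite -(big_nat_recr _ _ (fun i => nu i - nu m))//= sum_nu_sub; lra.
Qed.

(** If [a <= c], entries after [m] would not exceed [c], so the whole excess over [c] would come
    from the first [m] entries and be at most [eps]. *)
Lemma level_gt_mean a m : (1 <= m <= d - 1)%N ->
  \sum_(1 <= i < m.+1) (nu i - a) = eps -> nu m.+1 <= a < nu m -> c < a.
Proof.
move=> /andP[m1 md] sa /andP[am1 am]; rewrite ltNge; apply/negP => ac.
move: excess; apply/negP; rewrite -leNgt -sa.
have md' : (m < d)%N by rewrite (leq_ltn_trans md)// subn1 prednK// ltnW.
rewrite (@big_cat_nat _ _ _ m.+1)//=; last by rewrite ltnS ltnW.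
rewrite [X in _ + X]big1_seq ?addr0; last first.
  move=> i /=; rewrite mem_index_iota => /andP[mi id].
  apply/max_idPr; rewrite subr_le0; apply: le_trans ac; apply: le_trans am1.
  by rewrite nu_dec.
apply: ler_sum_nat => i /andP[i1 im].
have nmi : nu m <= nu i by rewrite nu_dec// ltnW.
by rewrite ge_max; apply/andP; split; lra.
Qed.

End LevelExistence.

Lemma psum_shift (R : realType) d (x : nat -> R) k : (k <= d)%N ->
  psum (fun i : 'I_d => x i.+1) k = \sum_(1 <= i < k.+1) x i.
Proof. by move=> kd; rewrite (psumE (fun i => x i.+1))// big_add1/= big_mkord. Qed.

Lemma sum_shift (R : realType) d (x : nat -> R) :
  \sum_(i < d) x i.+1 = \sum_(1 <= i < d.+1) x i.
Proof. by rewrite big_add1/= big_mkord. Qed.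

(** * The spectrum of the lower extremal state *)

Section LowerSpectrum.
Variables (R : realType) (d : nat) (q : nat -> R) (eps : R).
Hypotheses (d2 : (2 <= d)%N) (q0 : forall i, (1 <= i <= d)%N -> 0 <= q i).
Hypotheses (q1 : \sum_(1 <= i < d.+1) q i = 1) (eps0 : 0 < eps).

Local Notation p := (lower_spectrum d eps q).
Local Notation tail s := (\sum_(s <= j < d.+1) q j).

(** [q d <= eps] makes [l = 1] admissible, so the maximum is attained at an admissible index and is
    not the default [0]. *)
Lemma tail_indexP : q d <= eps -> let l := tail_index d eps q in
  [/\ (0 < l < d)%N, tail_sum d q l <= eps &
      ((l.+1 < d)%N -> eps < tail_sum d q l.+1)].
Proof.
move=> qd; rewrite /tail_index.
have d1 : (1 < d)%N by [].
have t1 : tail_sum d q 1 <= eps 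
  by rewrite /tail_sum (_ : d - 1 + 1 = d)%N ?big_nat1//; lia.
pose P := fun l : 'I_d => (0 < l)%N && (tail_sum d q l <= eps).
have [|i iP iE] := @eq_bigmax_cond _ P (@nat_of_ord d).
  by apply/card_gt0P; exists (Ordinal d1); apply/andP.
rewrite iE; have /andP[i0 it] : P i by [].
split=> //; first by rewrite i0 ltn_ord.
move=> id; rewrite ltNge; apply/negP => ti.
have := @leq_bigmax_cond _ P (@nat_of_ord d) (Ordinal id).
by rewrite /P /= ti => /(_ isT); rewrite iE ltnn.
Qed.

Lemma tail_index_full : tail_sum d q (d - 1) <= eps -> tail_index d eps q = (d - 1)%N.
Proof.
move=> td; apply/eqP; rewrite eqn_leq; apply/andP; split.
  by apply/bigmax_leqP => i _; have := ltn_ord i; lia.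
have d1 : (d - 1 < d)%N by lia.
pose P := fun l : 'I_d => (0 < l)%N && (tail_sum d q l <= eps).
have := @leq_bigmax_cond _ P (@nat_of_ord d) (Ordinal d1).
by rewrite /P /= td subn_gt0 d2 => /(_ isT).
Qed.

(* The three cases of [lower_spectrum]: a mass [e] is moved to the first entry from
   the end of the sequence, emptying all entries after the one of index [s]. *)
Lemma lower_spectrum_shape : exists e s,
  [/\ (2 <= s <= d)%N, 0 <= e <= eps, tail s.+1 <= e <= tail s,
      e = eps \/ (s = 2 /\ e = tail 2) &
      forall j, (1 <= j <= d)%N -> p j =
        if j == 1%N then q 1%N + e else if (j < s)%N then q j
        else if j == s then tail s - e else 0].
Proof.
have tailS s : (1 <= s <= d)%N -> tail s = q s + tail s.+1.
  by move=> sd; rewrite big_ltn//; lia.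
have tail0 s : (1 <= s)%N -> 0 <= tail s.
  move=> s1; rewrite big_seq; apply: sumr_ge0 => j.
  by rewrite mem_index_iota => jd; apply: q0; lia.
have tail_d : tail d.+1 = 0 by rewrite big_geq.
have [qd|qd] := ltP eps (q d).
  exists eps, d; split; rewrite ?leqnn ?d2 ?lexx ?ltW ?tail_d//=.
  - by rewrite tailS ?tail_d ?addr0 ?ltW//; lia.
  - by left.
  - move=> j jd; rewrite /lower_spectrum qd tailS ?tail_d ?addr0; last lia.
    case: eqP => // _; case: ltngtP => //; lia.
have [/andP[l0 ld] tl tl1] := tail_indexP qd.
rewrite /lower_spectrum ltNge qd/=; set l := tail_index d eps q in l0 ld tl tl1 *.
have tE k : (k < d)%N -> tail_sum d q k = tail (d - k).+1.
  by move=> kd; rewrite /tail_sum addn1.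
case: eqP => [lE|lE].
  have t2 : tail_sum d q l = tail 2 by rewrite tE//; congr (\sum_(_ <= j < _) q j); lia.
  (* Everything after the first entry is emptied, and the mass moved may be smaller than [eps]. *)
  exists (tail 2), 2%N; split; rewrite ?d2 ?leqnn//.
  - by rewrite tail0// -t2.
  - by rewrite lexx andbT [leRHS]tailS// lerDr q0.
  - by right.
  - move=> j jd; case: eqP => [_|j1]; first by rewrite -q1 -tailS//; lia.
    by case: ltnP => [|_]; [lia|rewrite subrr; case: ifP].
have sE : (d - l).+1 = (d - l.+1).+2 by lia.
(* Coming from the end, entry [d - l] is the first that [eps] cannot empty, by maximality of [l]. *)
exists eps, (d - l)%N; split.
- lia.
- by rewrite lexx andbT ltW.
- rewrite -tE// tl/= ltW//; have : (l.+1 < d)%N by lia.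
  by move=> ld1; move: (tl1 ld1); rewrite tE//; congr (_ < \sum_(_ <= j < _) q j); lia.
- by left.
- move=> j jd; case: eqP => // _.
  have -> : (j <= d - l - 1)%N = (j < d - l)%N by lia.
  case: ifP => // _; case: eqP => // _.
  by rewrite tailS ?tE//; [lra|lia].
Qed.

(** Both alternatives for prefix sums serve majorization: a state in the ball gains at most [eps] on
    a prefix, and no prefix exceeds [1]. Only the first entry increases, which bounds the
    distance. *)
Lemma lower_spectrumP :
  [/\ forall i, (1 <= i <= d)%N -> 0 <= p i,
      \sum_(1 <= i < d.+1) p i = 1,
      forall k, (0 < k < d)%N ->
        \sum_(1 <= i < k.+1) p i = \sum_(1 <= i < k.+1) q i + eps \/
        \sum_(1 <= i < k.+1) p i = 1 &
      \sum_(1 <= i < d.+1) Num.max (p i - q i) 0 <= eps].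
Proof.
have [e [s [sd e0 te es pE]]] := lower_spectrum_shape.
move: (p) pE => r pE.
have low k : (0 < k < s)%N -> (k <= d)%N ->
    \sum_(1 <= i < k.+1) r i = \sum_(1 <= i < k.+1) q i + e.
  move=> ks kd; rewrite !(@big_ltn _ _ _ 1 k.+1); [|lia..].
  rewrite pE ?eqxx; last lia.
  rewrite [LHS]addrAC; congr (_ + _ + _); apply: eq_big_nat => j jk.
  rewrite pE; last lia.
  by case: eqP; [lia|]; case: ifP => //; lia.
have high k : (s <= k <= d)%N -> \sum_(1 <= i < k.+1) r i = 1.
  move=> ks; rewrite (@big_cat_nat _ _ _ s)/=; [|lia..].
  have -> : \sum_(1 <= i < s) r i = \sum_(1 <= i < s) q i + e.
    by have := low s.-1; rewrite prednK; [apply; lia|lia].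
  rewrite big_ltn; last lia.
  rewrite [X in _ + (_ + X)]big1_seq => [|j /andP[_]]; last first.
    rewrite mem_index_iota => jk; rewrite pE; last lia.
    by case: eqP; [lia|]; case: ifP; [lia|]; case: eqP => //; lia.
  rewrite pE; last lia.
  case: eqP; [lia|]; rewrite ltnn eqxx => _.
  by rewrite -q1 (@big_cat_nat _ _ _ s 1 d.+1)/=; [lra|lia..].
split.
- move=> i id; rewrite pE//; case: eqP => _.
    by rewrite addr_ge0 ?q0//; [lia|lra].
  by case: ifP => _; [exact: q0|]; case: ifP => _ //; lra.
- by apply: high; lia.
- move=> k kd; case: (ltnP k s) => ks; last by right; apply: high; lia.
  rewrite low; [|lia..].
  (* If [e] is not [eps], then [s = 2], the only rank below [s] is [1], and the first entry carries
     everything. *)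
  case: es => [->|[s2 eE]]; first by left.
  right; have -> : k = 1%N by lia.
  by rewrite big_nat1 eE -q1 [RHS]big_ltn//; lia.
- rewrite big_ltn//; last lia.
  rewrite [X in _ + X]big1_seq ?addr0 => [|j /andP[_]]; last first.
    rewrite mem_index_iota => jd; rewrite pE; last lia.
    apply/max_idPr; rewrite subr_le0.
    case: eqP; [lia|] => _; case: ifP => // _.
    case: eqP => [->|_]; last by apply: q0; lia.
    by rewrite big_ltn; [lra|lia].
  rewrite pE; last lia.
  by rewrite eqxx [q 1%N + e]addrC addrK ge_max; lra.
Qed.

Lemma lower_spectrum_pure : q d <= eps -> tail_sum d q (d - 1) <= eps ->
  p = pure_spectrum.
Proof.
move=> qd td; apply: boolp.funext => j.
by rewrite /lower_spectrum ltNge qd/= tail_index_full// eqxx.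
Qed.

End LowerSpectrum.

(* [lia] restricted to the hypotheses on natural numbers: its preprocessing is very
   slow on those about real numbers. *)
Ltac nat_lia :=
  repeat match goal with
  | H : ?P |- _ =>
    lazymatch P with
    | is_true (leq _ _) => fail
    | is_true (leq _ _ && _) => fail
    | is_true (~~ _) => fail
    | @eq nat _ _ => fail
    | @eq bool _ _ => fail
    | ~ (@eq nat _ _) => fail
    | _ => clear H
    end
  end; lia.

(** * The spectrum of the upper extremal state *)

Section UpperSpectrum.
Variables (R : realType) (d : nat) (mu : nat -> R) (eps : R).
Hypotheses (d2 : (2 <= d)%N) (eps0 : 0 < eps).
Hypothesis mu_dec :
  forall i j, (1 <= i)%N -> (i <= j)%N -> (j <= d)%N -> mu j <= mu i.
Hypothesis mu0 : forall i, (1 <= i <= d)%N -> 0 <= mu i.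
Hypothesis mu1 : \sum_(1 <= i < d.+1) mu i = 1.
Hypothesis far : eps < 2^-1 * \sum_(1 <= i < d.+1) `|mu i - d%:R^-1|.

Let mu_le1 i : (1 <= i <= d)%N -> mu i <= 1.
Proof.
move=> id; rewrite -mu1 (@big_cat_nat _ _ _ i)/=; [|nat_lia..].
rewrite [X in _ + X]big_ltn/=; last nat_lia.
have ge0 a b : (1 <= a)%N -> (b <= d.+1)%N -> 0 <= \sum_(a <= j < b) mu j.
  move=> a1 bd; rewrite big_seq; apply: sumr_ge0 => j.
  by rewrite mem_index_iota => ab; apply: mu0; nat_lia.
have := ge0 1%N i isT; have := ge0 i.+1 d.+1 isT (leqnn _).
by move=> ? /(_ ltac:(nat_lia)) ?; lra.
Qed.

Let half_norm_nat (x : nat -> R) : \sum_(1 <= i < d.+1) x i = 0 ->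
  2^-1 * \sum_(1 <= i < d.+1) `|x i| = \sum_(1 <= i < d.+1) Num.max (x i) 0.
Proof.
by rewrite !big_add1/= !big_mkord => x0; exact: half_norm_sum.
Qed.

Let sum_centered : \sum_(1 <= i < d.+1) (mu i - d%:R^-1) = 0.
Proof.
rewrite sumrB mu1 sumr_const_nat subn1/= -[X in _ - X]mulr_natl divff ?subrr//.
by rewrite pnatr_eq0; nat_lia.
Qed.

Let high_excess : eps < \sum_(1 <= i < d.+1) Num.max (mu i - d%:R^-1) 0.
Proof. by rewrite -half_norm_nat. Qed.

(** Negating and reversing exchanges the two ends: raising the last [n] entries of [mu] to [a] is
    cutting the first [n] entries of [rev_mu] to [- a]. *)
Let rev_mu i := - mu (d.+1 - i)%N.

Let sum_rev (F : R -> R) n : (n <= d)%N ->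
  \sum_(1 <= i < n.+1) F (rev_mu i) = \sum_(d - n + 1 <= i < d.+1) F (- mu i).
Proof.
move=> nd; rewrite [RHS]big_nat_rev/= [in RHS]addnC big_addn.
have -> : (d.+1 - (d - n) = n.+1)%N by nat_lia.
by apply: eq_big_nat => i id; congr (F (- mu _)); nat_lia.
Qed.

Let rev_dec i j : (1 <= i)%N -> (i <= j)%N -> (j <= d)%N -> rev_mu j <= rev_mu i.
Proof. by move=> i1 ij jd; rewrite lerN2 mu_dec//; nat_lia. Qed.

Let rev_mean : \sum_(1 <= i < d.+1) rev_mu i = d%:R * - d%:R^-1.
Proof.
rewrite (sum_rev id)// subnn add0n sumrN mu1 mulrN divff//.
by rewrite pnatr_eq0; nat_lia.
Qed.

Let rev_excess : eps < \sum_(1 <= i < d.+1) Num.max (rev_mu i - - d%:R^-1) 0.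
Proof.
rewrite (sum_rev (fun x => Num.max (x - - d%:R^-1) 0))// subnn add0n.
under eq_bigr do rewrite opprK addrC.
rewrite -half_norm_nat; first by under eq_bigr do rewrite distrC.
have /(congr1 -%R) := sum_centered; rewrite oppr0 -sumrN.
by under eq_bigr do rewrite opprB.
Qed.

Let mean : \sum_(1 <= i < d.+1) mu i = d%:R * d%:R^-1.
Proof. by rewrite mu1 divff// pnatr_eq0; nat_lia. Qed.

Let high_sum a m : (1 <= m <= d - 1)%N -> a < mu m ->
  \sum_(1 <= i < m.+1) `|a - mu i| = \sum_(1 <= i < m.+1) (mu i - a).
Proof.
move=> md am; apply: eq_big_nat => i im.
rewrite ler0_norm ?opprB// subr_le0; apply: le_trans (ltW am) _.
by apply: mu_dec; nat_lia.
Qed.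

Let low_sum a n : (1 <= n <= d - 1)%N -> mu (d - n + 1)%N < a ->
  \sum_(d - n + 1 <= i < d.+1) `|a - mu i| = \sum_(d - n + 1 <= i < d.+1) (a - mu i).
Proof.
move=> nd an; apply: eq_big_nat => i idn.
rewrite ger0_norm// subr_ge0; apply: le_trans (ltW an).
by apply: mu_dec; nat_lia.
Qed.

Let low_rev a n : (1 <= n <= d - 1)%N ->
  \sum_(1 <= i < n.+1) (rev_mu i - - a) = \sum_(d - n + 1 <= i < d.+1) (a - mu i).
Proof.
move=> nd; rewrite (sum_rev (fun x => x - - a)); last nat_lia.
by apply: eq_bigr => i _; rewrite opprK addrC.
Qed.

Lemma high_level_exists : exists am, high_level d eps mu am.
Proof.
have [a [m [md sa /andP[am1 am]]]] := level_exists d2 eps0 mu_dec mean high_excess.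
exists (a, m); split=> //.
- have m0 : 0 <= mu m.+1 by apply: mu0; nat_lia.
  have m1 : mu m <= 1 by apply: mu_le1; nat_lia.
  by apply/andP; split; lra.
- by rewrite high_sum.
- by rewrite addn1 am1.
Qed.

Lemma low_level_exists : exists an, low_level d eps mu an.
Proof.
have [a [n [nd sa]]] := level_exists d2 eps0 rev_dec rev_mean rev_excess.
rewrite /rev_mu => /andP[an1 an].
have E1 : (d.+1 - n.+1 = d - n)%N by nat_lia.
have E2 : (d.+1 - n = d - n + 1)%N by nat_lia.
rewrite E1 in an1; rewrite E2 in an.
have m0 : 0 <= mu (d - n + 1)%N by apply: mu0; nat_lia.
have m1 : mu (d - n)%N <= 1 by apply: mu_le1; nat_lia.
exists (- a, n); split=> //.
- by apply/andP; split; lra.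
- rewrite low_sum//; last by lra.
  by rewrite -low_rev// opprK.
- by apply/andP; split; lra.
Qed.

Lemma high_level_gt a m : high_level d eps mu (a, m) -> d%:R^-1 < a.
Proof.
case=> _ md sa /andP[am1 am]; rewrite high_sum// in sa.
apply: (level_gt_mean d2 mu_dec high_excess md sa).
by rewrite -addn1 am1.
Qed.

Lemma low_level_lt a n : low_level d eps mu (a, n) -> a < d%:R^-1.
Proof.
case=> _ nd sa /andP[an an1]; rewrite low_sum// -low_rev// in sa.
rewrite -ltrN2; apply: (level_gt_mean d2 rev_dec rev_excess nd sa).
rewrite /rev_mu lerN2 ltrN2.
have -> : (d.+1 - n.+1 = d - n)%N by nat_lia.
have -> : (d.+1 - n = d - n + 1)%N by nat_lia.
by rewrite an1.
Qed.

Section Levels.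
Variables (a1 a2 : R) (m n : nat).
Hypotheses (low : low_level d eps mu (a1, n)) (high : high_level d eps mu (a2, m)).
Let r i := if (i <= m)%N then a2 else if (i <= d - n)%N then mu i else a1.

(** If the plateaus overlapped, [a2 < mu m <= mu (d - n + 1) < a1] would contradict
    [a1 < 1/d < a2]. *)
Let mdn : (m <= d - n)%N.
Proof.
have [_ nd _ /andP[n1 _]] := low; have [_ md _ /andP[_ m1]] := high.
have a1d := low_level_lt low; have a2d := high_level_gt high.
rewrite leqNgt; apply/negP => dnm.
have : mu m <= mu (d - n + 1)%N by apply: mu_dec; nat_lia.
by lra.
Qed.

Let split3 (F : nat -> R) : \sum_(1 <= i < d.+1) F i =
  \sum_(1 <= i < m.+1) F i + \sum_(m.+1 <= i < d - n + 1) F i +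
  \sum_(d - n + 1 <= i < d.+1) F i.
Proof.
have [_ nd _ _] := low.
rewrite (@big_cat_nat _ _ _ (d - n + 1))/=; [|nat_lia..].
by rewrite (@big_cat_nat _ _ _ m.+1 1)/=; [|nat_lia..].
Qed.

Let r_low (F : nat -> R -> R) :
  \sum_(d - n + 1 <= i < d.+1) F i (r i) = \sum_(d - n + 1 <= i < d.+1) F i a1.
Proof.
apply: eq_big_nat => i idn; congr (F i _); rewrite /r.
by rewrite ifN ?ifN//; have := mdn; nat_lia.
Qed.

Let r_high (F : nat -> R -> R) :
  \sum_(1 <= i < m.+1) F i (r i) = \sum_(1 <= i < m.+1) F i a2.
Proof. by apply: eq_big_nat => i im; congr (F i _); rewrite /r ifT//; nat_lia. Qed.

Let r_mid (F : nat -> R -> R) k : (k <= d - n + 1)%N ->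
  \sum_(m.+1 <= i < k) F i (r i) = \sum_(m.+1 <= i < k) F i (mu i).
Proof.
move=> kd; apply: eq_big_nat => i im; congr (F i _).
by rewrite /r ifN ?ifT//; nat_lia.
Qed.

Let high_excessE : \sum_(1 <= i < m.+1) (mu i - a2) = eps.
Proof. by have [_ md sa /andP[_ m1]] := high; rewrite -high_sum. Qed.

Let low_deficitE : \sum_(d - n + 1 <= i < d.+1) (a1 - mu i) = eps.
Proof. by have [_ nd sa /andP[n1 _]] := low; rewrite -low_sum. Qed.

(** From rank [m] to rank [d - n], a prefix of [r] has lost exactly the [eps] cut at the top. At
    other ranks two consecutive entries lie on the same plateau, so every strict drop falls in that
    range. The mass cut equals the mass filled in, whence the total and the distance. *)
Lemma upper_spectrumP :
  [/\ forall i, (1 <= i <= d)%N -> 0 < r i,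
      \sum_(1 <= i < d.+1) r i = 1,
      2^-1 * \sum_(1 <= i < d.+1) `|r i - mu i| = eps &
      forall k, (1 <= k < d)%N -> r k.+1 <= r k /\
        (r k.+1 < r k -> \sum_(1 <= i < k.+1) r i =
                         \sum_(1 <= i < k.+1) mu i - eps)].
Proof.
have a1d := low_level_lt low; have a2d := high_level_gt high.
have [_ nd sl /andP[n1 n2]] := low; have [_ md sh /andP[m1 m2]] := high.
have mn0 : 0 <= mu (d - n + 1)%N by apply: mu0; nat_lia.
have sum_prefix k : (m <= k <= d - n)%N ->
    \sum_(1 <= i < k.+1) r i = \sum_(1 <= i < k.+1) mu i - eps.
  move=> mk; apply/eqP; rewrite -subr_eq0 opprB addrA addrAC -sumrB; apply/eqP.
  rewrite (@big_cat_nat _ _ _ m.+1)/=; [|nat_lia..].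
  rewrite (r_mid (fun i x => x - mu i)); last nat_lia.
  rewrite (r_high (fun i x => x - mu i)).
  rewrite [X in _ + X + _]big1 ?addr0 => [|i _]; last by rewrite subrr.
  rewrite -high_excessE -big_split/= big1// => i _; ring.
split.
- move=> i id; rewrite /r; case: ifP => im; first lra.
  case: ifP => idn; last lra.
  have h : mu (d - n)%N <= mu i by apply: mu_dec; nat_lia.
  lra.
- rewrite -mu1; apply/eqP; rewrite -subr_eq0 -sumrB split3.
  rewrite (r_low (fun i x => x - mu i)) (r_mid (fun i x => x - mu i))//.
  rewrite (r_high (fun i x => x - mu i)) [X in _ + X + _]big1 => [|i _]; last first.
    by rewrite subrr.
  rewrite addr0 low_deficitE -high_excessE -big_split/=.
  by apply/eqP; rewrite big1// => i _; ring.
- rewrite split3 (r_low (fun i x => `|x - mu i|)) (r_mid (fun i x => `|x - mu i|))//.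
  rewrite (r_high (fun i x => `|x - mu i|)) sl sh [X in _ + X + _]big1 => [|i _].
    by lra.
  by rewrite subrr normr0.
- move=> k kd; have [km|mk] := ltnP k m.
    by rewrite /r km (ltnW km) ltxx.
  have [dnk|kdn] := ltnP (d - n) k.
    by rewrite /r !ifN ?ltxx//; nat_lia.
  split=> [|_]; last by apply: sum_prefix; rewrite mk.
  rewrite /r [in leLHS]ifN; last nat_lia.
  case: (leqP k m) => [km|mk'].
    have -> : k = m by nat_lia.
    case: ifP => _; last lra.
    by rewrite -addn1.
  rewrite kdn; case: ifP => kdn'; first by apply: mu_dec; nat_lia.
  by have -> : k = (d - n)%N by nat_lia.
Qed.

(** Only the first entry of [mu] is nonzero, so [0 < a1 <= mu (d - n)] forces [d - n = 1] and
    [0 <= a2 < mu m] forces [m = 1]; the two mass equations then give the levels. *)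
Lemma upper_spectrum_pure : (forall i, (1 <= i <= d)%N -> mu i = pure_spectrum i) ->
  forall i, (1 <= i <= d)%N -> r i = spread_spectrum d eps i.
Proof.
move=> mup i id.
have [_ nd sl /andP[n1 n2]] := low; have [_ md sh /andP[m1 m2]] := high.
have mn0 : 0 <= mu (d - n + 1)%N by apply: mu0; nat_lia.
have mm0 : 0 <= mu (m + 1)%N by apply: mu0; nat_lia.
have dn1 : (d - n = 1)%N.
  apply/eqP; apply: contraT => dn; have : mu (d - n)%N = 0.
    by rewrite mup /pure_spectrum ?ifN//; nat_lia.
  by move=> h; exfalso; lra.
have m_1 : (m = 1)%N.
  apply/eqP; apply: contraT => m_n1; have : mu m = 0.
    by rewrite mup /pure_spectrum ?ifN//; nat_lia.
  by move=> h; exfalso; lra.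
have p1 : mu 1 = 1 by rewrite mup; [|nat_lia].
rewrite /r dn1 m_1 /spread_spectrum.
have := high_excessE; rewrite m_1 big_nat1 p1 => e2.
have [i1|i1] := leqP i 1.
  have -> : i = 1%N by nat_lia.
  by rewrite /=; lra.
rewrite ifN; last nat_lia.
have := low_deficitE; rewrite dn1.
under eq_big_nat => j jd.
  rewrite mup; last nat_lia.
  rewrite /pure_spectrum ifN; last nat_lia.
  rewrite subr0; over.
rewrite sumr_const_nat => <-; rewrite (_ : d.+1 - (1 + 1) = d - 1)%N; last nat_lia.
by rewrite -[_ *+ _]mulr_natr mulfK// pnatr_eq0; nat_lia.
Qed.

End Levels.
End UpperSpectrum.

(** * Matrices diagonalised by a unitary *)

Section Spectral.
Local Open Scope sesquilinear_scope.
Variables (R : realType) (d : nat).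
Local Notation C := R[i].
Implicit Types (A U V W : 'M[C]_d) (x y : 'I_d -> R) (p : nat -> R).

Definition udiag U x : 'M[C]_d := U *m diag_mx (\row_i (x i)%:C) *m U^t*.

Lemma conj_real (a : R) : Num.conj (a%:C : C) = a%:C.
Proof. by apply/CrealP; rewrite complex_real. Qed.

Lemma adjmxM m n k (A : 'M[C]_(m, n)) (B : 'M[C]_(n, k)) :
  (A *m B)^t* = B^t* *m A^t*.
Proof. by rewrite trmx_mul map_mxM. Qed.

Lemma unitarymx_adjK U : U \is unitarymx -> U^t* *m U = 1%:M.
Proof. by move=> Uu; have := unitarymxP Uu; exact: mulmx1C. Qed.

Lemma diag_inE U p : diag_in U p = udiag U (fun i => p i.+1).
Proof.
apply/matrixP => i j; rewrite /diag_in summxE /udiag mul_mx_diag mxE.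
apply: eq_bigr => k _; rewrite !mxE big_ord1 !mxE mulrA; congr (_ * _).
exact: mulrC.
Qed.

Lemma eq_udiag U x y : x =1 y -> udiag U x = udiag U y.
Proof.
by move=> xy; congr (_ *m diag_mx _ *m _); apply/rowP => i; rewrite !mxE xy.
Qed.

Lemma udiag_adj U x : (udiag U x)^t* = udiag U x.
Proof.
have De : (diag_mx (\row_i (x i)%:C))^t* = diag_mx (\row_i (x i)%:C) :> 'M[C]_d.
  rewrite tr_diag_mx map_diag_mx; congr diag_mx.
  by apply/rowP => i; rewrite !mxE; exact: conj_real.
by rewrite /udiag adjmxM adjmxM trmxCK De mulmxA.
Qed.

Lemma udiag_herm U x : udiag U x \is hermsymmx.
Proof. by apply/is_hermitianmxP; rewrite expr0 scale1r udiag_adj. Qed.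

(** Affine functions of a matrix do not depend on the eigenbasis, which lets states written in
    different bases be compared. *)
Lemma udiag_affine U (a b : R) x : U \is unitarymx ->
  udiag U (fun i => a * x i + b) = a%:C *: udiag U x + b%:C%:M.
Proof.
move=> Uu; rewrite /udiag.
have -> : diag_mx (\row_i (a * x i + b)%:C) =
    a%:C *: diag_mx (\row_i (x i)%:C) + b%:C%:M :> 'M[C]_d.
  apply/matrixP => i j; rewrite !mxE; case: eqP => _.
    by rewrite !mulr1n rmorphD rmorphM.
  by rewrite !mulr0n mulr0 addr0.
rewrite mulmxDr mulmxDl -scalemxAr -scalemxAl; congr (_ + _).
by rewrite mul_mx_scalar -scalemxAl (unitarymxP Uu) scalemx1.
Qed.

Lemma udiag_mul U x y : U \is unitarymx ->
  udiag U x *m udiag U y = udiag U (fun i => x i * y i).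
Proof.
move=> Uu; have UU := unitarymx_adjK Uu.
rewrite /udiag !mulmxA -[U *m _ *m _ *m U]mulmxA UU mulmx1 -[U *m _ *m _]mulmxA.
congr (_ *m _ *m _); rewrite mulmx_diag; congr diag_mx.
by apply/rowP => i; rewrite !mxE rmorphM.
Qed.

Lemma udiag_trace U x : U \is unitarymx -> \tr (udiag U x) = (\sum_i x i)%:C.
Proof.
move=> Uu; rewrite /udiag mxtrace_mulC mulmxA.
rewrite (unitarymx_adjK Uu) mul1mx mxtrace_diag rmorph_sum; apply: eq_bigr => i _.
by rewrite mxE.
Qed.

(* If [A] is diagonalised as [P^* S P] and as [U D U^*], then [X = P U] satisfies
   [S X = X D], that is [s_i = d_j] wherever [X i j] is nonzero; hence also
   [f(S) X = X f(D)]. *)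
Lemma mx_fun_udiag f U x : U \is unitarymx ->
  mx_fun f (udiag U x) = udiag U (f \o x).
Proof.
move=> Uu; set A := udiag U x; set P := spectralmx A; set s := spectral_diag A.
have Pu : P \is unitarymx := spectral_unitarymx A.
have Punit := unitarymx_unit Pu.
have UU := unitarymx_adjK Uu.
have AE : A = invmx P *m diag_mx s *m P.
  exact/orthomx_spectralP/hermitian_normalmx/udiag_herm.
pose X := P *m U.
have com : diag_mx s *m X = X *m diag_mx (\row_i (x i)%:C).
  have PA : P *m A = diag_mx s *m P by rewrite AE -mulmxA mulKVmx.
  have AU : A *m U = U *m diag_mx (\row_i (x i)%:C).
    by rewrite /A /udiag -mulmxA UU mulmx1.
  by rewrite /X mulmxA -PA -[LHS]mulmxA AU [LHS]mulmxA.
have fcom : diag_mx (map_mx (fun z : C => (f (complex.Re z))%:C) s) *m X =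
    X *m diag_mx (\row_i (f (x i))%:C).
  move: (X) com => Y com; apply/matrixP => i j; have /matrixP/(_ i j) := com.
  rewrite !mul_diag_mx !mul_mx_diag !mxE mulrC.
  have [->|Yn0] := eqVneq (Y i j) 0; first by rewrite !mul0r mulr0.
  by move/(mulfI Yn0) => ->; rewrite mulrC.
rewrite /mx_fun -/A -/P -/s /udiag.
have PX : P = X *m U^t* by rewrite /X -mulmxA (unitarymxP Uu) mulmx1.
rewrite -[RHS]mul1mx -(mulVmx Punit) -!mulmxA; congr (_ *m _).
rewrite {1}PX (mulmxA _ X) fcom -mulmxA /X -!mulmxA; congr (P *m (U *m _)).
Qed.

Lemma hermitian_udiag A : A \is hermsymmx ->
  exists U x, U \is unitarymx /\ A = udiag U x.
Proof.
move=> Ah; pose P := spectralmx A.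
have Pu : P \is unitarymx := spectral_unitarymx A.
exists (P^t*), (fun i => complex.Re (spectral_diag A 0 i)).
split; first by rewrite trmxC_unitary.
have := orthomx_spectralP (hermitian_normalmx Ah).
rewrite -/P (invmx_unitary Pu) => AE; rewrite [LHS]AE /udiag trmxCK.
congr (_ *m diag_mx _ *m _).
apply/rowP => i; rewrite !mxE RRe_real//.
exact: (mxOverP (hermitian_spectral_diag_real Ah)).
Qed.

Lemma entropy_udiag U x : U \is unitarymx ->
  entropy (udiag U x) = shannon x / ln 2.
Proof.
move=> Uu; rewrite /entropy mx_fun_udiag// udiag_mul// udiag_trace//=.
by rewrite /shannon mulNr mulr_suml; congr (- _); apply: eq_bigr => i _; rewrite mulrA.
Qed.

Lemma trace_norm_udiag U x : U \is unitarymx ->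
  trace_norm (udiag U x) = \sum_i `|x i|.
Proof.
move=> Uu; rewrite /trace_norm /mx_abs udiag_adj udiag_mul// mx_fun_udiag//.
rewrite udiag_trace//=; apply: eq_bigr => i _.
by rewrite /= -expr2 sqrtr_sqr.
Qed.

Lemma udiag_perm U x (s : 'S_d) : U \is unitarymx ->
  exists2 V, V \is unitarymx & udiag U x = udiag V (x \o s).
Proof.
move=> Uu; exists (col_perm s U).
  apply/unitarymxP; rewrite -(unitarymxP Uu); apply/matrixP => i j; rewrite !mxE.
  rewrite [RHS](reindex_inj (@perm_inj _ s)); apply: eq_bigr => k _.
  by rewrite !mxE.
apply/matrixP => i j; rewrite /udiag !mul_mx_diag !mxE.
rewrite (reindex_inj (@perm_inj _ s)); apply: eq_bigr => k _.
by rewrite !mxE.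
Qed.

Lemma sorted_perm x : exists s : 'S_d,
  forall i j : 'I_d, (i <= j)%N -> x (s j) <= x (s i).
Proof.
pose t := [tuple x i | i < d].
have sz : size (sort >=%R t) == d by rewrite size_sort size_tuple.
have /tuple_permP[s sE] : perm_eq (Tuple sz) t by rewrite /= perm_sort.
exists s => i j ij.
have xE k : x (s k) = nth 0 (sort >=%R t) k.
  have -> : sort >=%R t = [tuple tnth t (s k) | k < d] by exact: sE.
  by rewrite -tnth_nth !tnth_mktuple.
have st : sorted >=%R (sort >=%R t) by apply: sort_sorted => a b; exact: le_total.
rewrite !xE; apply: (sorted_leq_nth ge_trans _ 0 st) => //.
- exact: lexx.
- by rewrite inE (eqP sz).
- by rewrite inE (eqP sz).
Qed.

Lemma hermitian_sorted A : A \is hermsymmx ->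
  exists U x, [/\ U \is unitarymx, A = udiag U x &
    forall i j : 'I_d, (i <= j)%N -> x j <= x i].
Proof.
move=> /hermitian_udiag[U [x [Uu ->]]].
have [s xs] := sorted_perm x; have [V Vu ->] := udiag_perm x s Uu.
by exists V, (x \o s); split.
Qed.

(** The entries [<u_i|A|u_i>]; their prefix sums are, for Hermitian [A], its traces against the
    projections onto the first columns of a unitary [U]. *)
Definition mdiag U A (i : 'I_d) : R := complex.Re ((U^t* *m A *m U) i i).

(** The numbers [|<u_i|v_j>|^2], doubly stochastic for unitary [U] and [V]. *)
Definition overlap U V i j : R := complex.Re (`|(U^t* *m V) i j| ^+ 2).

Lemma mdiag_udiag U V x i : mdiag U (udiag V x) i = \sum_j overlap U V i j * x j.
Proof.
rewrite /mdiag /udiag !mulmxA -[_ *m V^t* *m U]mulmxA.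
have -> : V^t* *m U = (U^t* *m V)^t* by rewrite adjmxM trmxCK.
rewrite /overlap; set X := U^t* *m V.
rewrite mul_mx_diag mxE raddf_sum; apply: eq_bigr => j _.
by rewrite !mxE mulrAC -normCK -add_Re2_Im2 -rmorphM.
Qed.

Lemma overlap_ge0 U V i j : 0 <= overlap U V i j.
Proof. by rewrite /overlap -add_Re2_Im2/= addr_ge0// sqr_ge0. Qed.

Lemma overlapC U V i j : overlap U V i j = overlap V U j i.
Proof.
rewrite /overlap; have -> : U^t* *m V = (V^t* *m U)^t*.
  by rewrite adjmxM trmxCK.
by rewrite !mxE norm_conjC.
Qed.

Lemma overlap_row U V i : U \is unitarymx -> V \is unitarymx ->
  \sum_j overlap U V i j = 1.
Proof.
move=> Uu Vu; have := mdiag_udiag U V (fun=> 1) i.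
under eq_bigr do rewrite mulr1.
move=> <-; rewrite /mdiag /udiag.
have -> : diag_mx (\row__ 1%:C) = 1%:M :> 'M[C]_d.
  by apply/matrixP => k l; rewrite !mxE.
rewrite mulmx1 (unitarymxP Vu) mulmx1.
by rewrite (unitarymx_adjK Uu) mxE eqxx.
Qed.

Lemma overlap_col U V j : U \is unitarymx -> V \is unitarymx ->
  \sum_i overlap U V i j = 1.
Proof.
by move=> Uu Vu; under eq_bigr do rewrite overlapC; rewrite overlap_row.
Qed.

Lemma mdiag_id U x i : U \is unitarymx -> mdiag U (udiag U x) i = x i.
Proof.
move=> Uu; rewrite /mdiag /udiag !mulmxA.
have UU := unitarymx_adjK Uu.
by rewrite UU mul1mx -mulmxA UU mulmx1 !mxE eqxx mulr1n.
Qed.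

Lemma mdiagB U A B i : mdiag U (A - B) i = mdiag U A i - mdiag U B i.
Proof. by rewrite /mdiag mulmxBr mulmxBl !mxE raddfB. Qed.

Lemma udiag_inj U x y : U \is unitarymx -> udiag U x = udiag U y -> x =1 y.
Proof. by move=> Uu e i; rewrite -(mdiag_id x i Uu) e mdiag_id. Qed.

Lemma sum_mdiag U A : U \is unitarymx -> A \is hermsymmx ->
  \sum_i mdiag U A i = complex.Re (\tr A).
Proof.
move=> Uu /hermitian_udiag[V [x [Vu ->]]].
under eq_bigr do rewrite mdiag_udiag.
rewrite exchange_big/= udiag_trace//=; apply: eq_bigr => j _.
by rewrite -mulr_suml overlap_col// mul1r.
Qed.

Lemma mdiag_psd U A i : psdmx A -> 0 <= mdiag U A i.
Proof.
case=> _ /(_ (col i U)); rewrite /mdiag.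
have -> : ((col i U)^t* *m A *m col i U) 0 0 = (U^t* *m A *m U) i i.
  rewrite colE trmx_mul map_mxM trmx_delta map_delta_mx -!mulmxA -rowE.
  by rewrite !mulmxA -colE !mxE.
by rewrite lecE => /andP[].
Qed.

Lemma psdmx_udiag U x : U \is unitarymx ->
  psdmx (udiag U x) <-> forall i, 0 <= x i.
Proof.
move=> Uu; split=> [psd i|x0]; first by rewrite -(mdiag_id x i Uu) mdiag_psd.
split=> [|v]; first exact: udiag_herm.
rewrite /udiag !mulmxA -[_ *m U^t* *m v]mulmxA.
have -> : v^t* *m U = (U^t* *m v)^t* by rewrite adjmxM trmxCK.
move: (U^t* *m v) => w; rewrite mul_mx_diag mxE; apply: sumr_ge0 => k _.
by rewrite !mxE mulrAC [_ * w k 0]mulrC -normCK mulr_ge0 ?exprn_ge0// ler0c.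
Qed.

Lemma state_udiag U x : U \is unitarymx ->
  state (udiag U x) <-> (forall i, 0 <= x i) /\ \sum_i x i = 1.
Proof.
move=> Uu; rewrite /state (udiag_trace _ Uu); split=> [[xpsd x1]|[x0 x1]].
  by split; [exact: (psdmx_udiag x Uu).1|exact: (@complexI R)].
by split; [exact: (psdmx_udiag x Uu).2|rewrite x1].
Qed.

Lemma state_sorted rho : state rho ->
  exists U x, [/\ U \is unitarymx, rho = udiag U x, forall i, 0 <= x i,
    \sum_i x i = 1 & forall i j : 'I_d, (i <= j)%N -> x j <= x i].
Proof.
move=> rs; have [[/hermitian_sorted[U [x [Uu rE xs]]] _] _] := rs.
by move: rs; rewrite rE => /(state_udiag _ Uu)[x0 x1]; exists U, x.
Qed.

(** The eigenvalues of [A - B] sum to zero, and the difference of prefix sums weights each of them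
    by the squared norm of its projected eigenvector, which lies in [[0, 1]]. *)
Lemma trace_norm_psum U A B k : U \is unitarymx -> state A -> state B ->
  `|psum (mdiag U A) k - psum (mdiag U B) k| <= 2^-1 * trace_norm (A - B).
Proof.
move=> Uu [[Ah _] A1] [[Bh _] B1].
have ABh : A - B \is hermsymmx.
  apply/is_hermitianmxP; rewrite expr0 scale1r linearB/= map_mxB.
  have := is_hermitianmxP _ _ _ Ah; rewrite expr0 scale1r => <-.
  by have := is_hermitianmxP _ _ _ Bh; rewrite expr0 scale1r => <-.
rewrite -psumB; have -> : psum (fun i => mdiag U A i - mdiag U B i) k =
    psum (mdiag U (A - B)) k by apply: eq_bigr => i _; rewrite mdiagB.
have : \tr (A - B) = 0 by rewrite linearB/= A1 B1 subrr.
have [V [x [Vu ->]]] := hermitian_udiag ABh.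
rewrite udiag_trace// trace_norm_udiag// => /complexI x0.
have -> : psum (mdiag U (udiag V x)) k =
    \sum_j (\sum_(i < d | (i < k)%N) overlap U V i j) * x j.
  under [RHS]eq_bigr do rewrite mulr_suml.
  by rewrite exchange_big; apply: eq_bigr => i _; rewrite mdiag_udiag.
apply: sum_weights_le_half_norm => // j; rewrite sumr_ge0 => [|i _]/=.
  rewrite -(overlap_col j Uu Vu) [leRHS](bigID (fun i : 'I_d => (i < k)%N))/= lerDl.
  by apply: sumr_ge0 => i _; exact: overlap_ge0.
exact: overlap_ge0.
Qed.

(** The squared norms of the projected eigenvectors are weights in [[0, 1]] of total [k]; placing
    them on the [k] largest eigenvalues is optimal. *)
Lemma ky_fan U V x k : U \is unitarymx -> V \is unitarymx -> (k < d)%N ->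
  (forall i j : 'I_d, (i <= j)%N -> x j <= x i) ->
  psum (mdiag U (udiag V x)) k <= psum x k.
Proof.
move=> Uu Vu kd xs.
have -> : psum (mdiag U (udiag V x)) k =
    \sum_j (\sum_(i < d | (i < k)%N) overlap U V i j) * x j.
  under [RHS]eq_bigr do rewrite mulr_suml.
  by rewrite exchange_big; apply: eq_bigr => i _; rewrite mdiag_udiag.
apply: sum_weights_le_psum => // [j|].
  rewrite sumr_ge0 => [|i _]/=; last exact: overlap_ge0.
  rewrite -(overlap_col j Uu Vu) [leRHS](bigID (fun i : 'I_d => (i < k)%N))/= lerDl.
  by apply: sumr_ge0 => i _; exact: overlap_ge0.
rewrite exchange_big/=; under eq_bigr do rewrite overlap_row//.
by rewrite -(big_ord_widen _ (fun=> 1) (ltnW kd)) sumr_const card_ord.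
Qed.

End Spectral.

(** * Entropy comparison from prefix sums, and entropies of special states *)

Section Entropy.
Local Open Scope sesquilinear_scope.
Variables (R : realType) (d : nat).
Local Notation C := R[i].
Implicit Types (omega U V W : 'M[C]_d) (x y r : 'I_d -> R).

Lemma ln2_gt0 : 0 < ln 2 :> R.
Proof. by rewrite ln_gt0// ltr1n. Qed.

(** Klein's inequality passes to the cross entropy of the diagonal of [omega] in the basis [U]. Abel
    summation then applies, as [- ln r] rises only where [r] strictly drops. *)
Lemma entropy_le_plateau U r omega : U \is unitarymx -> state omega ->
  (forall i, 0 < r i) -> \sum_i r i = 1 ->
  (forall i j : 'I_d, j = i.+1 :> nat ->
    r j <= r i /\ (r j < r i -> psum r j <= psum (mdiag U omega) j)) ->
  entropy omega <= entropy (udiag U r).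
Proof.
move=> Uu os r0 r1 rdec; have [[oh _] o1] := os.
have w1 : \sum_i mdiag U omega i = 1 by rewrite (sum_mdiag Uu oh) o1.
have [V [l [Vu oE l0 l1 _]]] := state_sorted os.
rewrite {1}oE !entropy_udiag// ler_pM2r ?invr_gt0 ?ln2_gt0//.
have := @gibbs_bistochastic R d (overlap U V) l r (overlap_ge0 _ _)
  (fun i => overlap_row i Uu Vu) (fun j => overlap_col j Uu Vu) l0 r0.
rewrite l1 r1 => /(_ erefl) /le_trans; apply.
under eq_bigr do rewrite -mdiag_udiag -oE.
rewrite /shannon -subr_le0 opprK addrC -sumrB.
under eq_bigr do rewrite -mulrBl -[_ - _]opprK opprB mulNr -mulrN.
apply: (@abel_le0 _ _ (fun i => mdiag U omega i - r i)
  (fun i => - ln (r i))) => [|i j ji]; first by rewrite sumrB w1 r1 subrr.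
have [rji rlt] := rdec i j ji; split; first by rewrite lerN2 ler_ln ?posrE.
by rewrite ltrN2 ltr_ln ?posrE// psumB subr_ge0.
Qed.

(** On the span of the first [k] eigenvectors of [omega], its trace exceeds that of [udiag U x] by
    at most [eps], and the latter is at most [psum x k] by Ky Fan. Hence [y] majorizes the spectrum
    of [omega]. *)
Lemma entropy_ge_majorized U x y eps omega : U \is unitarymx -> state omega ->
  state (udiag U x) -> (forall i j : 'I_d, (i <= j)%N -> x j <= x i) ->
  2^-1 * trace_norm (omega - udiag U x) <= eps ->
  (forall i, 0 <= y i) -> \sum_i y i = 1 ->
  (forall k, (0 < k < d)%N -> psum y k = psum x k + eps \/ psum y k = 1) ->
  entropy (udiag U y) <= entropy omega.
Proof.
move=> Uu os xs xdec oe y0 y1 ymaj.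
have [V [l [Vu oE l0 l1 lsorted]]] := state_sorted os.
rewrite oE !entropy_udiag// ler_pM2r ?invr_gt0 ?ln2_gt0//.
apply: karamata_shannon => // [|k kd]; first by rewrite l1 y1.
have [->|k0] := eqVneq k 0%N; first by rewrite !psum0.
have [|->|->] := ymaj k; first by rewrite lt0n k0.
  have -> : psum l k = psum (mdiag V omega) k.
    by apply: eq_bigr => i _; rewrite oE; apply/esym; exact: mdiag_id.
  rewrite -lerBlDl; apply: le_trans oe.
  apply: le_trans (trace_norm_psum k Vu os xs); apply: le_trans (ler_norm _).
  by rewrite lerB// ky_fan.
rewrite -l1 [leRHS](bigID (fun i : 'I_d => (i < k)%N))/= lerDl.
exact: sumr_ge0.
Qed.

Lemma pure_udiag U x : U \is unitarymx ->
  pure_state (udiag U x) <-> exists j, forall i, x i = (i == j)%:R.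
Proof.
move=> Uu; have Uunit := unitarymx_unit Uu.
have rE : \rank (udiag U x) = \rank (diag_mx (\row_i (x i)%:C)).
  have Us : U^t* \in unitmx by apply: unitarymx_unit; rewrite trmxC_unitary.
  rewrite /udiag mxrankMfree; last by rewrite row_free_unit Us.
  by rewrite -mxrank_tr trmx_mul mxrankMfree ?mxrank_tr// row_free_unit unitmx_tr.
rewrite /pure_state rE; split.
  case=> /(state_udiag _ Uu)[x0 x1] r1.
  (* A rank-one matrix is a column times a row, so [D j j * D k k = D j k * D k j], which is zero
     for a diagonal matrix. *)
  have xx j k : j != k -> x j * x k = 0.
    move=> jk; apply: (@complexI R); rewrite rmorphM/=.
    set D := diag_mx _ in r1.
    have DE i : D i i = (x i)%:C by rewrite !mxE eqxx.
    have Djk : D j k = 0 by rewrite !mxE (negbTE jk).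
    rewrite -!DE; move: (col_base D) (row_base D) (mulmx_base D).
    rewrite r1 => c e DE'; rewrite -DE' !mxE !big_ord1.
    move: Djk; rewrite -DE' mxE big_ord1 => ce.
    by rewrite mulrACA [e 0 j * _]mulrC mulrACA ce mul0r.
  have [j xj] : exists j, x j != 0.
    apply/existsP; rewrite -negb_forall; apply/negP => /forallP xz.
    have /eqP := x1; rewrite big1 ?(eq_sym 0) ?oner_eq0// => i _.
    exact/eqP/xz.
  have xz i : i != j -> x i = 0.
    by move=> /xx/eqP; rewrite mulf_eq0 (negbTE xj) orbF => /eqP.
  exists j => i; have [->|/xz//] := eqVneq i j.
  by move: x1; rewrite (bigD1 j)//= big1 ?addr0.
case=> j xj; split.
  apply/state_udiag => //; split=> [i|]; first by rewrite xj.
  rewrite (bigD1 j)//= xj eqxx big1 ?addr0// => i /negbTE ij.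
  by rewrite xj ij.
have -> : diag_mx (\row_i (x i)%:C) = delta_mx j j :> 'M[C]_d.
  apply/matrixP => i k; rewrite !mxE xj.
  have [->|ij] /= := eqVneq i j; last by rewrite mul0rn.
  by rewrite eq_sym; case: eqP.
exact: mxrank_delta.
Qed.

Lemma shannon_delta (j : 'I_d) : shannon (fun i => (i == j)%:R) = 0 :> R.
Proof.
rewrite /shannon big1 ?oppr0// => i _.
by case: eqP => _; rewrite ?ln1 ?mulr0 ?mul0r.
Qed.

Lemma shannon_fano (j : 'I_d) (e : R) : (2 <= d)%N ->
  shannon (fun i => if i == j then 1 - e else e / (d - 1)%:R) = fano_bound d e.
Proof.
move=> d2; rewrite /shannon (bigD1 j)//= eqxx.
under eq_bigr => i /negbTE -> do [].
rewrite sumr_const cardC1 card_ord -subn1 -[_ *+ (d - 1)]mulr_natl mulrA.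
rewrite /fano_bound opprD; congr (_ - _).
have d0 : (d - 1)%:R != 0 :> R by rewrite pnatr_eq0 subn_eq0 -ltnNge.
by rewrite mulrCA divff// mulr1.
Qed.

Lemma shannon_uniform : (0 < d)%N -> shannon (fun _ : 'I_d => d%:R^-1) = ln d%:R :> R.
Proof.
move=> d0; rewrite /shannon sumr_const card_ord -[X in - X]mulr_natl mulrA divff.
  by rewrite mul1r lnV ?opprK// posrE ltr0n.
by rewrite pnatr_eq0 -lt0n.
Qed.

Lemma uniform_boundE (e : R) : (2 <= d)%N -> 0 < e -> e < 1 - d%:R^-1 ->
  uniform_bound d e = fano_bound d e / ln 2.
Proof.
move=> d2 e0 ed; rewrite /uniform_bound ed /binary_entropy /log2 /fano_bound.
rewrite ln_div ?posrE ?ltr0n ?subn_gt0//; ring.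
Qed.

Lemma tauE U : U \is unitarymx -> tau = udiag U (fun=> d%:R^-1).
Proof.
move=> Uu; rewrite -[RHS](eq_udiag U (x := fun i => 0 * 0 + d%:R^-1)); last first.
  by move=> i; rewrite mul0r add0r.
rewrite (udiag_affine 0 _ (fun=> 0) Uu) scale0r add0r /tau.
by rewrite fmorphV rmorph_nat.
Qed.

End Entropy.

(** * The extremal states *)

Section Extremal.
Variables (R : realType) (d : nat) (sigma U : 'M[R[i]]_d) (mu : nat -> R) (eps : R).
Hypotheses (hd : (2 <= d)%N) (hsigma : state sigma).
Hypothesis hdec : eigendecomposition sigma U mu.
Hypothesis heps0 : 0 < eps.

Local Notation m := (fun i : 'I_d => mu i.+1).
Local Notation rho_up := (rho_upper eps sigma U mu).
Local Notation rho_low := (rho_lower eps U mu).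
Local Notation case2 := (eps < 1 - d%:R^-1 /\
    exists2 V : 'M[R[i]]_d, V \is unitarymx &
      sigma = diag_in V (spread_spectrum d eps)).
Local Notation case3 := (1 - d%:R^-1 <= eps /\ sigma = tau).

Let o : 'I_d := Ordinal (ltnW hd).

Let Uu : U \is unitarymx. Proof. by case: hdec. Qed.

Let sE : sigma = udiag U m.
Proof. by case: hdec => _ -> _; rewrite diag_inE. Qed.

Let mu_dec i j : (1 <= i)%N -> (i <= j)%N -> (j <= d)%N -> mu j <= mu i.
Proof. by case: hdec => _ _; apply. Qed.

Let m_dec (i j : 'I_d) : (i <= j)%N -> m j <= m i.
Proof. by move=> ij; apply: mu_dec. Qed.

Let m_state : (forall i, 0 <= m i) /\ \sum_i m i = 1.
Proof. by apply/(state_udiag _ Uu); rewrite -sE. Qed.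

Let m0 := m_state.1.
Let m1 := m_state.2.

Let mu0 i : (1 <= i <= d)%N -> 0 <= mu i.
Proof. by case: i => // i id; exact: (m0 (Ordinal id)). Qed.

Let mu1 : \sum_(1 <= i < d.+1) mu i = 1.
Proof. by rewrite -sum_shift m1. Qed.

Let m01 i : 0 <= m i <= 1.
Proof.
rewrite m0 -m1 (bigD1 i)//= lerDl; apply: sumr_ge0 => j _; exact: m0.
Qed.

Let d_gt0 : 0 < d%:R :> R. Proof. by rewrite ltr0n ltnW. Qed.

Let sum_uniform : \sum_(i < d) d%:R^-1 = 1 :> R.
Proof. by rewrite sumr_const card_ord -[LHS]mulr_natl divff// gt_eqF. Qed.

Lemma trace_norm_sub_tau :
  trace_norm (sigma - tau) = \sum_(i < d) `|m i - d%:R^-1|.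
Proof.
rewrite -(trace_norm_udiag _ Uu); congr trace_norm.
rewrite -(eq_udiag U (x := fun i => 1 * m i + - d%:R^-1)); last first.
  by move=> i; rewrite mul1r.
rewrite (udiag_affine _ _ _ Uu) scale1r -sE; congr (_ + _).
rewrite /tau -scaleN1r scale_scalar_mx mulN1r; congr (_%:M).
by rewrite rmorphN fmorphV rmorph_nat.
Qed.

Lemma rho_upperP : exists r : 'I_d -> R,
  [/\ rho_up = udiag U r, forall i, 0 < r i, \sum_i r i = 1,
      2^-1 * \sum_i `|r i - m i| <= eps &
      forall omega, trace_ball eps sigma omega -> entropy omega <= entropy rho_up].
Proof.
rewrite /rho_upper; case: ifPn => [near|].
  exists (fun=> d%:R^-1); split.
  - exact: tauE.
  - by move=> _; rewrite invr_gt0.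
  - exact: sum_uniform.
  - by rewrite trace_norm_sub_tau in near; under eq_bigr do rewrite distrC.
  (* A constant spectrum has no strict drop, so the prefix-sum condition is vacuous. *)
  - move=> omega [os _]; rewrite (tauE Uu); apply: entropy_le_plateau => //.
    by move=> _; rewrite invr_gt0.
    by move=> i j _; rewrite ltxx.
rewrite -ltNge trace_norm_sub_tau (sum_shift _ (fun i => `|mu i - d%:R^-1|)) => far.
(* Both sets of levels are nonempty, so [xget] returns a member and not the default pair. *)
have hi := xgetPex (0, 0%N) (high_level_exists hd heps0 mu_dec mu0 mu1 far).
have lo := xgetPex (0, 0%N) (low_level_exists hd heps0 mu_dec mu0 mu1 far).
case: (xget _ (low_level _ _ _)) lo => a1 n lo.
case: (xget _ (high_level _ _ _)) hi => a2 k hi.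
pose r i := if (i <= k)%N then a2 else if (i <= d - n)%N then mu i else a1.
rewrite -/r /=; set D := diag_in U _.
have DE : D = udiag U (fun i => r i.+1) by exact: diag_inE.
have [r0 r1 rm rdec] := upper_spectrumP hd mu_dec mu0 mu1 far lo hi.
exists (fun i => r i.+1); split=> [//||||].
- by move=> i; apply: r0; rewrite ltn_ord.
- by rewrite sum_shift.
- by rewrite (sum_shift _ (fun i => `|r i - mu i|)) rm.
move=> omega [os oe]; rewrite DE; apply: entropy_le_plateau => //.
- by move=> i; apply: r0; rewrite ltn_ord.
- by rewrite sum_shift.
move=> i j ji; have jd : (i.+1 < d)%N by rewrite -ji.
rewrite ji; have [|rd rlt] := rdec i.+1; first by [].
split=> // /rlt rE; rewrite psum_shift ?rE; last exact: ltnW.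
rewrite -(psum_shift mu (ltnW jd)).
have := trace_norm_psum i.+1 Uu os hsigma.
have -> : psum (mdiag U sigma) i.+1 = psum m i.+1.
  by apply: eq_bigr => l _; rewrite sE; exact: mdiag_id.
by move/le_trans/(_ oe); rewrite ler_norml => /andP[h _]; rewrite lerBlDr; lra.
Qed.

Lemma rho_lowerP : exists p : 'I_d -> R,
  [/\ rho_low = udiag U p, forall i, 0 <= p i, \sum_i p i = 1,
      2^-1 * \sum_i `|m i - p i| <= eps &
      forall omega, trace_ball eps sigma omega -> entropy rho_low <= entropy omega].
Proof.
have [p0 p1 pm pe] := lower_spectrumP hd mu0 mu1 heps0.
rewrite /rho_lower diag_inE; move: (lower_spectrum d eps mu) p0 p1 pm pe => p p0 p1 pm pe.
have p0' (i : 'I_d) : 0 <= p i.+1 by apply: p0; rewrite ltn_ord.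
exists (fun i => p i.+1); split; [by []|exact: p0'| | |].
- by rewrite sum_shift.
- under eq_bigr do rewrite distrC.
  rewrite (half_norm_sum (x := fun i : 'I_d => p i.+1 - mu i.+1)).
    by rewrite (sum_shift _ (fun i => Num.max (p i - mu i) 0)).
  by rewrite sumrB m1 sum_shift p1 subrr.
move=> omega [os oe].
apply: (@entropy_ge_majorized _ _ U m _ eps omega Uu os _ m_dec _ p0').
- by rewrite -sE.
- by rewrite -sE.
- by rewrite sum_shift.
- move=> k kd; have kd' : (k <= d)%N by case/andP: kd => _ /ltnW.
  by rewrite !psum_shift//; exact: pm.
Qed.

Lemma pure_sigmaP : pure_state sigma <-> forall i : 'I_d, m i = (i == o)%:R.
Proof.
rewrite {1}sE; split=> [/(pure_udiag _ Uu)[j mj]|mo]; last first.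
  by apply/(pure_udiag _ Uu); exists o.
suff -> : o = j by [].
apply/eqP; apply: contraT => oj; have := @m_dec o j (leq0n _).
by rewrite !mj eqxx (negbTE oj) ler10.
Qed.

Let spreadE (i : 'I_d) :
  spread_spectrum d eps i.+1 = if i == o then 1 - eps else eps / (d - 1)%:R.
Proof. by []. Qed.

Let pureE (i : 'I_d) : pure_spectrum i.+1 = (i == o)%:R :> R.
Proof. by rewrite /pure_spectrum eqSS -val_eqE /=; case: ifP. Qed.

(** The gap between the two eigenvalues of the spread state, which is affine in a rank-one
    projection with this coefficient. *)
Let slope := 1 - eps - eps / (d - 1)%:R.

Let spread_affine (x : 'I_d -> R) V : V \is unitarymx ->
  (forall i, x i = (i == o)%:R) ->
  diag_in V (spread_spectrum d eps) =
    slope%:C *: udiag V x + (eps / (d - 1)%:R)%:C%:M.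
Proof.
move=> Vu xo; rewrite diag_inE -(udiag_affine _ _ _ Vu); apply: eq_udiag => i.
by rewrite spreadE xo; case: eqP => _ /=; rewrite /slope; ring.
Qed.

Lemma rho_upper_pure : pure_state sigma ->
  rho_up = if eps < 1 - d%:R^-1 then diag_in U (spread_spectrum d eps) else tau.
Proof.
move=> /pure_sigmaP mo; rewrite /rho_upper.
(* Only the first eigenvalue exceeds [1/d], so the distance to [tau] is [1 - 1/d] and the test in
   [rho_upper] becomes the case distinction on [eps]. *)
have tE : 2^-1 * trace_norm (sigma - tau) = 1 - d%:R^-1.
  rewrite trace_norm_sub_tau (half_norm_sum (x := fun i => m i - d%:R^-1)); last first.
    by rewrite sumrB m1 sum_uniform subrr.
  have mo1 : mu 1 = 1 by have := mo o; rewrite eqxx.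
  rewrite (bigD1 o)//= mo1 big1 => [|i io].
    rewrite addr0; apply/max_idPl; rewrite subr_ge0 invf_le1//.
    by rewrite ler1n ltnW.
  by apply/max_idPr; rewrite mo (negbTE io) sub0r oppr_le0 invr_ge0 ltW.
rewrite tE leNgt if_neg; case: ifP => // ed.
have far : eps < 2^-1 * \sum_(1 <= i < d.+1) `|mu i - d%:R^-1|.
  by rewrite -(sum_shift _ (fun i => `|mu i - d%:R^-1|)) -trace_norm_sub_tau tE.
have hi := xgetPex (0, 0%N) (high_level_exists hd heps0 mu_dec mu0 mu1 far).
have lo := xgetPex (0, 0%N) (low_level_exists hd heps0 mu_dec mu0 mu1 far).
case: (xget _ (low_level _ _ _)) lo => a1 n lo.
case: (xget _ (high_level _ _ _)) hi => a2 k hi.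
rewrite !diag_inE; apply: eq_udiag => i.
apply: (upper_spectrum_pure hd mu_dec mu0 mu1 far lo hi); last by rewrite ltn_ord.
move=> j; case: j => // j jd; exact: etrans (mo (Ordinal jd)) (esym (pureE _)).
Qed.

(** Inverting the affine map turns [sigma] into a rank-one projection, whose spectrum in the basis
    [U] has a single one; the decreasing order puts it first. *)
Lemma spread_sigma : case2 -> forall i, m i = spread_spectrum d eps i.+1.
Proof.
case=> ed [V Vu sV] i.
have sl : 0 < slope by have := fano_ratio_lt hd ed; rewrite /slope; lra.
set b := eps / (d - 1)%:R in sl *.
have xm : udiag U (fun i => slope^-1 * m i + - (slope^-1 * b)) =
    udiag V (fun i => (i == o)%:R).
  have cE : slope^-1%:C *: b%:C%:M = (slope^-1 * b)%:C%:M :> 'M[R[i]]_d.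
    by rewrite scale_scalar_mx -rmorphM.
  have cN : (- (slope^-1 * b))%:C%:M = - (slope^-1 * b)%:C%:M :> 'M[R[i]]_d.
    by rewrite !raddfN.
  rewrite (udiag_affine _ _ _ Uu) -sE sV cN.
  rewrite (spread_affine Vu (x := fun i => (i == o)%:R))//.
  by rewrite scalerDr -/b cE addrK scalerA -rmorphM mulVf ?gt_eqF// scale1r.
have : pure_state (udiag U (fun i => slope^-1 * m i + - (slope^-1 * b))).
  by rewrite xm; apply/(pure_udiag _ Vu); exists o.
case/(pure_udiag _ Uu) => j xj.
have mE k : m k = slope * (k == j)%:R + b.
  by rewrite -xj mulrDr mulrN !mulrA mulfV ?gt_eqF// !mul1r subrK.
have jo : j = o.
  apply/eqP; apply: contraT => jo; have := @m_dec o j (leq0n _).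
  by rewrite !mE eqxx (eq_sym o) (negbTE jo) mulr1 mulr0 => h; exfalso; lra.
rewrite mE jo spreadE; case: eqP => _ /=; rewrite /slope -/b; lra.
Qed.

Lemma uniform_sigma : sigma = tau -> forall i, m i = d%:R^-1.
Proof. by rewrite (tauE Uu) {1}sE => /(udiag_inj Uu). Qed.

(** Emptying the flat tail costs [(d - 1) * c], within the budget [eps]. Cases 2 and 3 both have
    such a tail. *)
Lemma lower_spectrum_flat c : (forall j, (2 <= j <= d)%N -> mu j = c) ->
  (d - 1)%:R * c <= eps -> lower_spectrum d eps mu = pure_spectrum.
Proof.
move=> muc ce; have dE : mu d = c by apply: muc; lia.
have c0 : 0 <= c by rewrite -dE mu0//; lia.
apply: lower_spectrum_pure => //.
  rewrite dE; apply: le_trans ce; rewrite ler_peMl//.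
  by rewrite ler1n; lia.
rewrite /tail_sum (_ : d - (d - 1) + 1 = 2)%N; last lia.
rewrite (eq_big_nat _ _ (F2 := fun=> c)) => [|j jd]; last by apply: muc; lia.
rewrite sumr_const_nat (_ : d.+1 - 2 = d - 1)%N; last lia.
by rewrite -mulr_natl.
Qed.

Lemma rho_lower_pure : case2 \/ case3 -> rho_low = diag_in U pure_spectrum.
Proof.
rewrite /rho_lower => -[c2|[de st]].
  rewrite (@lower_spectrum_flat (eps / (d - 1)%:R))//.
    move=> [//|j] jd; have jd' : (j < d)%N by lia.
    rewrite (spread_sigma c2 (Ordinal jd')) spreadE ifN//.
    by rewrite -val_eqE /=; lia.
  by rewrite mulrCA divff ?mulr1// pnatr_eq0; lia.
rewrite (@lower_spectrum_flat d%:R^-1)//.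
  move=> [//|j] jd; have jd' : (j < d)%N by lia.
  exact: (uniform_sigma st (Ordinal jd')).
by rewrite natr_subn1// mulrBl divff ?gt_eqF// mul1r.
Qed.

Lemma pure_spectrum_pure : pure_state (diag_in U pure_spectrum).
Proof.
by rewrite diag_inE; apply/(pure_udiag _ Uu); exists o => i; rewrite pureE.
Qed.

Let entropy_pure : entropy (diag_in U pure_spectrum) = 0.
Proof.
rewrite diag_inE (eq_udiag _ pureE) (entropy_udiag _ Uu).
by rewrite (shannon_delta R) mul0r.
Qed.

Let entropy_tau : entropy (tau : 'M[R[i]]_d) = log2 d%:R.
Proof. by rewrite (tauE Uu) (entropy_udiag _ Uu) shannon_uniform// ltnW. Qed.

Let entropy_spread : eps < 1 - d%:R^-1 ->
  entropy (diag_in U (spread_spectrum d eps)) = uniform_bound d eps.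
Proof.
move=> ed; rewrite diag_inE (eq_udiag _ spreadE) (entropy_udiag _ Uu).
by rewrite shannon_fano// uniform_boundE.
Qed.

Let entropy_sigma_pure : pure_state sigma -> entropy sigma = 0.
Proof.
move=> /pure_sigmaP mo; rewrite sE (eq_udiag _ mo) (entropy_udiag _ Uu).
by rewrite (shannon_delta R) mul0r.
Qed.

Let shannon_le_ln (p : 'I_d -> R) : (forall i, 0 <= p i) -> \sum_i p i = 1 ->
  shannon p <= ln d%:R /\ (shannon p = ln d%:R -> forall i, p i = d%:R^-1).
Proof.
move=> p0 p1; have u0 (i : 'I_d) : 0 < d%:R^-1 :> R by rewrite invr_gt0.
have pu : \sum_i p i = \sum_(i < d) d%:R^-1 by rewrite p1 sum_uniform.
have uE : - \sum_i p i * ln (d%:R^-1) = ln d%:R.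
  by rewrite -mulr_suml p1 mul1r lnV ?opprK ?posrE.
have := gibbs p0 u0 pu; have := gibbs_eq p0 u0 pu; rewrite uE; by split.
Qed.

Let divr_ln2_inj (x y : R) : x / ln 2 = y / ln 2 -> x = y.
Proof. by apply: mulIf; rewrite invr_eq0 gt_eqF// ln2_gt0. Qed.

(** For [eps < 1 - 1/d] this is Fano's bound for [r] against [m], tight only if [m] is a point mass.
    Otherwise [shannon r <= ln d] and [shannon m >= 0]; tightness makes every eigenvalue of [sigma]
    zero or one. *)
Lemma entropy_upper_gap : entropy rho_up - entropy sigma <= uniform_bound d eps /\
  (entropy rho_up - entropy sigma = uniform_bound d eps <-> pure_state sigma).
Proof.
have [r [rE r0 r1 rm _]] := rho_upperP.
have gapE : entropy rho_up - entropy sigma = (shannon r - shannon m) / ln 2.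
  by rewrite rE sE !(entropy_udiag _ Uu) mulrBl.
have r0' i : 0 <= r i by exact: ltW.
have pure_eq : pure_state sigma ->
    entropy rho_up - entropy sigma = uniform_bound d eps.
  move=> ps; rewrite (entropy_sigma_pure ps) subr0 (rho_upper_pure ps).
  case: ifPn => [/entropy_spread//|ed].
  by rewrite /uniform_bound (negbTE ed) entropy_tau.
rewrite gapE in pure_eq *.
have [ed|ed] := ltP eps (1 - d%:R^-1).
  rewrite uniform_boundE// in pure_eq *; split.
    by rewrite ler_pM2r ?invr_gt0 ?ln2_gt0// fano_le.
  split=> // /divr_ln2_inj e.
  have [j mj] := fano_eq hd r0' m0 r1 m1 rm heps0 ed e.
  by rewrite sE; apply/(pure_udiag _ Uu); exists j => i; have [] := mj i.
have bE : uniform_bound d eps = ln d%:R / ln 2.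
  by rewrite /uniform_bound ltNge ed.
rewrite bE in pure_eq *; have [rd _] := shannon_le_ln r0' r1.
have sm0 := shannon_ge0 m01; split.
  by rewrite ler_pM2r ?invr_gt0 ?ln2_gt0//; lra.
split=> // /divr_ln2_inj e; have me : shannon m = 0 by lra.
have m_01 := shannon_eq0 m01 me.
have mo1 : m o = 1.
  have [mo|//] := m_01 o; have := m1; rewrite big1 => [/eqP|i _].
    by rewrite eq_sym oner_eq0.
  by apply/eqP; rewrite eq_le m0 andbT -mo m_dec.
apply/pure_sigmaP => i; have [->|io] := eqVneq i o; first exact: mo1.
have := m1; rewrite (bigD1 o)//= mo1 => e1.
have s0 : \sum_(i < d | i != o) m i = 0 by lra.
exact: (@psumr_eq0P _ _ (fun i => i != o) m (fun i _ => m0 i) s0 i io).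
Qed.

(** Here [m] takes the first place in Fano's bound, and tightness makes it the spread spectrum. For
    [eps >= 1 - 1/d], tightness in [shannon m <= ln d] makes it uniform. *)
Lemma entropy_lower_gap : entropy sigma - entropy rho_low <= uniform_bound d eps /\
  (entropy sigma - entropy rho_low = uniform_bound d eps <-> case2 \/ case3).
Proof.
have [p [pE p0 p1 pm _]] := rho_lowerP.
have gapE : entropy sigma - entropy rho_low = (shannon m - shannon p) / ln 2.
  by rewrite pE {1}sE !(entropy_udiag _ Uu) mulrBl.
have case_eq : case2 \/ case3 ->
    entropy sigma - entropy rho_low = uniform_bound d eps.
  move=> c; rewrite (rho_lower_pure c) entropy_pure subr0.
  case: c => [c2|[de ->]]; last first.
    by rewrite entropy_tau /uniform_bound ltNge de.
  rewrite sE (eq_udiag _ (spread_sigma c2)) -entropy_spread; last by case: c2.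
  by rewrite diag_inE.
rewrite gapE in case_eq *.
have [ed|ed] := ltP eps (1 - d%:R^-1).
  rewrite uniform_boundE// in case_eq *; split.
    by rewrite ler_pM2r ?invr_gt0 ?ln2_gt0// fano_le.
  split=> [/divr_ln2_inj e|[[_ c]|[]//]]; last by apply: case_eq; left.
  left; split=> //; exists U => //.
  have [j mj] := fano_eq hd m0 p0 m1 p1 pm heps0 ed e.
  (* As [1 - eps > eps / (d - 1)], the decreasing order puts the larger eigenvalue first. *)
  have jo : j = o.
    apply/eqP; apply: contraT => jo; have := @m_dec o j (leq0n _).
    have [_ ->] := mj o; have [_ ->] := mj j.
    rewrite eqxx eq_sym (negbTE jo) => h.
    by have := fano_ratio_lt hd ed; rewrite ltNge h.
  rewrite diag_inE sE; apply: eq_udiag => i.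
  by have [_ ->] := mj i; rewrite jo spreadE.
have bE : uniform_bound d eps = ln d%:R / ln 2.
  by rewrite /uniform_bound ltNge ed.
rewrite bE in case_eq *; have [md mdE] := shannon_le_ln m0 m1.
have p01 i : 0 <= p i <= 1.
  by rewrite p0 -p1 (bigD1 i)//= lerDl; apply: sumr_ge0.
have sp0 := shannon_ge0 p01; split.
  by rewrite ler_pM2r ?invr_gt0 ?ln2_gt0//; lra.
split=> [/divr_ln2_inj e|[[//]|[_ c]]]; last by apply: case_eq; right.
right; split=> //.
rewrite sE (tauE Uu); apply: eq_udiag; apply: mdE; lra.
Qed.

(** The spread state is an affine function of [sigma], hence the same in every basis with
    [sigma = diag(1, 0, ..., 0)]. *)
Lemma rho_upper_pure_basis V : pure_state sigma -> V \is unitarymx ->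
  sigma = diag_in V pure_spectrum ->
  rho_up = if eps < 1 - d%:R^-1 then diag_in V (spread_spectrum d eps) else tau.
Proof.
move=> ps Vu sV; rewrite (rho_upper_pure ps); case: ifP => [_|_]; last by [].
rewrite (spread_affine Vu (x := fun i => pure_spectrum i.+1))// -diag_inE -sV.
by move/pure_sigmaP: (ps) => mo; rewrite (spread_affine Uu mo) -sE.
Qed.

Lemma sigma_pure_basis : pure_state sigma -> sigma = diag_in U pure_spectrum.
Proof.
move=> /pure_sigmaP mo; rewrite {1}sE diag_inE; apply: eq_udiag => i.
by rewrite mo pureE.
Qed.

End Extremal.

(** * Combination of the two gaps *)

Lemma distr_le_max (R : realDomainType) (x y a b : R) : a <= x -> x <= b ->
  `|x - y| <= Num.max (b - y) (y - a).
Proof.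
move=> ax xb; rewrite le_max !ler_norml.
by case: (leP 0 (x - y)) => xy; apply/orP; [left|right]; apply/andP; split; lra.
Qed.

Lemma max_le_eq (R : realDomainType) (x y b : R) (P Q : Prop) :
  x <= b /\ (x = b <-> P) -> y <= b /\ (y = b <-> Q) ->
  Num.max x y <= b /\ (Num.max x y = b <-> P \/ Q).
Proof.
move=> [xb xP] [yb yQ]; split; first by rewrite ge_max xb.
split=> [|PQ]; first by case: leP => _; [move/yQ; right|move/xP; left].
apply/eqP; rewrite eq_le ge_max xb yb /= le_max.
by case: PQ => [/xP|/yQ] ->; rewrite lexx ?orbT.
Qed.

Theorem proposition3p3 (R : realType) (d : nat) (hd : (2 <= d)%N)
    (sigma : 'M[R[i]]_d) (hsigma : state sigma)
    (U : 'M[R[i]]_d) (mu : nat -> R) (hdec : eigendecomposition sigma U mu)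
    (eps : R) (heps0 : 0 < eps) (heps1 : eps <= 1) :
  let rho_up := rho_upper eps sigma U mu in
  let rho_low := rho_lower eps U mu in
  let M := Num.max (entropy rho_up - entropy sigma)
                   (entropy sigma - entropy rho_low) in
  let case1 := pure_state sigma in
  let case2 := eps < 1 - d%:R^-1 /\
    exists2 V : 'M[R[i]]_d, V \is unitarymx &
      sigma = diag_in V (spread_spectrum d eps) in
  let case3 := 1 - d%:R^-1 <= eps /\ sigma = tau in
  [/\ forall omega : 'M[R[i]]_d, trace_ball eps sigma omega ->
        `|entropy omega - entropy sigma| <= M,
      M <= uniform_bound d eps,
      M = uniform_bound d eps <-> [\/ case1, case2 | case3],
      case1 ->
        (exists2 V : 'M[R[i]]_d, V \is unitarymx & sigma = diag_in V pure_spectrum) /\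
        (forall V : 'M[R[i]]_d, V \is unitarymx -> sigma = diag_in V pure_spectrum ->
           rho_up = if eps < 1 - d%:R^-1
                    then diag_in V (spread_spectrum d eps) else tau) &
      (case2 -> pure_state rho_low) /\ (case3 -> pure_state rho_low)].
Proof.
move=> rho_up rho_low M case1 case2 case3.
have [_ [_ _ _ _ up_max]] := rho_upperP hd hsigma hdec heps0.
have [_ [_ _ _ _ low_min]] := rho_lowerP hd hsigma hdec heps0.
have [M_le M_eq] := max_le_eq (entropy_upper_gap hd hsigma hdec heps0)
  (entropy_lower_gap hd hsigma hdec heps0).
have low_pure : case2 \/ case3 -> pure_state rho_low.
  move=> c; rewrite /rho_low (rho_lower_pure hd hsigma hdec heps0 c).
  exact: pure_spectrum_pure hdec.
split.
- move=> omega om; have uo := up_max _ om; have lo := low_min _ om.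
  exact: distr_le_max lo uo.
- exact: M_le.
- apply: (iff_trans M_eq); split=> [[c|[c|c]]|[c|c|c]].
  + exact: Or31.
  + exact: Or32.
  + exact: Or33.
  + by left.
  + by right; left.
  + by right; right.
- move=> c1; split.
    exists U; first by case: hdec.
    exact: sigma_pure_basis hdec c1.
  by move=> V Vu sV; exact: (rho_upper_pure_basis hd hsigma hdec heps0 c1 Vu sV).
- by split=> c; apply: low_pure; [left|right].
Qed.
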